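(* Let $G$ be a finite connected graph with colouring $\omega$ from colour-set $C$, and suppose $G$ has at most $N$ connected subgraphs. Then $m_G(G,\omega,d)$ for every $d \in C$, and hence $m_G(G,\omega)$, can be computed in time $O(|C|^3 \cdot N^3)$.
   Context: Flood-filling game: a graph $G=(V,E)$ carries a colouring $\omega:V\to C$ (not necessarily proper). A move $(v,d)$ with $v\in V$, $d\in C$ gives colour $d$ to every vertex of the monochromatic component of $v$ (the maximal connected set of vertices containing $v$ all having the same colour as $v$). Moves may be played at any vertex. $m_G(G,\omega,d)$ is the minimum number of moves needed to make every vertex of $G$ have colour $d$, and $m_G(G,\omega)=\min_{d\in C} m_G(G,\omega,d)$. *)

(* Defs.v *)
From mathcomp Require Import all_boot.

Set Implicit Arguments.
Unset Strict Implicit.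
Unset Printing Implicit Defensive.

Section Flooding.

Variables (V C : finType) (e : rel V).

Definition graph_connected : bool :=
  (0 < #|V|) && [forall x, forall y, connect e x y].

Definition edges : {set {set V}} :=
  [set f | [exists x, exists y, e x y && (f == [set x; y])]].

(* A subgraph is a pair (vertex set, edge set); it need not be induced. *)
Definition is_subgraph (H : {set V} * {set {set V}}) : bool :=
  (H.2 \subset edges) && [forall f in H.2, f \subset H.1].

(* The graph with no vertices does not count as connected. *)
Definition connected_subgraph (H : {set V} * {set {set V}}) : bool :=
  [&& is_subgraph H, H.1 != set0 &
      [forall x in H.1, forall y in H.1,
         connect (fun u v => [set u; v] \in H.2) x y]].

Definition num_connected_subgraphs : nat :=
  #|[set H | connected_subgraph H]|.

Definition mono_component (w : {ffun V -> C}) (v : V) : {set V} :=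
  [set u | connect (fun x y => e x y && (w x == w y)) v u].

Definition play_move (w : {ffun V -> C}) (m : V * C) : {ffun V -> C} :=
  [ffun u => if u \in mono_component w m.1 then m.2 else w u].

Definition play (w : {ffun V -> C}) (s : seq (V * C)) : {ffun V -> C} :=
  foldl play_move w s.

Definition floodable_in (w : {ffun V -> C}) (d : C) (k : nat) : bool :=
  [exists s : k.-tuple (V * C), play w s == [ffun=> d]].

Lemma play_all (w : {ffun V -> C}) (d : C) (s : seq V) (u : V) :
  (u \in s) || (w u == d) -> play w [seq (v, d) | v <- s] u = d.
Proof.
elim: s w => [|v s IH] w /=; first by move/eqP.
rewrite in_cons => Hu; apply: IH.
rewrite ffunE /=; case: ifP => [_|Hn]; first by rewrite eqxx orbT.
case/orP: Hu => [/orP[/eqP Euv|->]|->] //; last by rewrite orbT.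
by rewrite Euv inE connect0 in Hn.
Qed.

Lemma floodable_card (w : {ffun V -> C}) (d : C) : floodable_in w d #|V|.
Proof.
have sz : size [seq (v, d) | v <- enum V] == #|V| by rewrite size_map cardE.
apply/existsP; exists (Tuple sz); apply/eqP/ffunP => u.
by rewrite /= ffunE play_all // mem_enum.
Qed.

Lemma floodable_ex (w : {ffun V -> C}) (d : C) : exists k, floodable_in w d k.
Proof. by exists #|V|; apply: floodable_card. Qed.

Definition min_moves_to (w : {ffun V -> C}) (d : C) : nat :=
  ex_minn (floodable_ex w d).

Lemma min_moves_to_le_card (w : {ffun V -> C}) (d : C) :
  min_moves_to w d <= #|V|.
Proof.
by rewrite /min_moves_to; case: ex_minnP => k _; apply; apply: floodable_card.
Qed.

(* By min_moves_to_le_card the default value #|V| of the iterated minimum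
   never lowers it. *)
Definition min_moves (w : {ffun V -> C}) : nat :=
  \big[minn/#|V|]_(d : C) min_moves_to w d.

Lemma min_moves_le (w : {ffun V -> C}) (d : C) :
  min_moves w <= min_moves_to w d.
Proof.
rewrite /min_moves; move: (mem_index_enum d).
elim: (index_enum C) => //= d' r IH; rewrite in_cons big_cons.
by case/orP => [/eqP <-|/IH Hr]; rewrite geq_min ?leqnn ?Hr ?orbT.
Qed.

Lemma min_moves_attained (w : {ffun V -> C}) (d0 : C) :
  exists d, min_moves w = min_moves_to w d.
Proof.
case: (arg_minnP (P := predT) (min_moves_to w) (erefl true : predT d0)) => d _ Hd.
exists d; apply/eqP; rewrite eqn_leq min_moves_le /=.
rewrite /min_moves; elim/big_ind: _ => [|x y Hx Hy|d' _]; last exact: Hd.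
- exact: min_moves_to_le_card.
- by rewrite leq_min Hx Hy.
Qed.

End Flooding.

(* Unit-cost word RAM, presented as a structured language.  The memory consists
   of zero-initialised arrays of natural numbers; a program mentions finitely
   many of them, by fixed names, but indexes them with computed addresses.
   Every value that is read or computed, intermediate results and addresses
   included, must be smaller than B (words of log2 B bits): otherwise
   evaluation gets stuck, so that unit-cost arithmetic on huge numbers is not
   available. *)

Inductive binop := Add | Sub | Mul.

Inductive expr :=
| Const of nat
| Cell of nat & expr
| Bin of binop & expr & expr.

Inductive cmd :=
| Skip
| Store of nat & expr & expr   (* Store a i x is  a[i] := x *)
| Seq of cmd & cmd
| If of expr & cmd & cmd
| While of expr & cmd.

Definition memory := nat -> nat -> nat.

Definition write (s : memory) (a i x : nat) : memory :=
  fun b j => if (b == a) && (j == i) then x else s b j.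

Definition word (B x : nat) : option nat := if x < B then Some x else None.

Definition binop_sem (o : binop) : nat -> nat -> nat :=
  match o with Add => addn | Sub => subn | Mul => muln end.

Fixpoint eval (B : nat) (s : memory) (x : expr) : option nat :=
  match x with
  | Const k => word B k
  | Cell a i => if eval B s i is Some k then word B (s a k) else None
  | Bin o y z =>
      if eval B s y is Some k then
        if eval B s z is Some l then word B (binop_sem o k l) else None
      else None
  end.

Fixpoint expr_cost (x : expr) : nat :=
  match x with
  | Const _ => 1
  | Cell _ i => (expr_cost i).+1
  | Bin _ y z => (expr_cost y + expr_cost z).+1
  end.

(* exec B c s t s' : started in memory s, c halts in memory s' after exactly t
   elementary steps.  A test succeeds when its value is nonzero. *)
Inductive exec (B : nat) : cmd -> memory -> nat -> memory -> Prop :=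
| ExecSkip s : exec B Skip s 1 s
| ExecStore s a i x k l :
    eval B s i = Some k -> eval B s x = Some l ->
    exec B (Store a i x) s (expr_cost i + expr_cost x).+1 (write s a k l)
| ExecSeq c1 c2 s1 s2 s3 t1 t2 :
    exec B c1 s1 t1 s2 -> exec B c2 s2 t2 s3 ->
    exec B (Seq c1 c2) s1 (t1 + t2) s3
| ExecIfTrue x c1 c2 s s' k t :
    eval B s x = Some k.+1 -> exec B c1 s t s' ->
    exec B (If x c1 c2) s (expr_cost x + t).+1 s'
| ExecIfFalse x c1 c2 s s' t :
    eval B s x = Some 0 -> exec B c2 s t s' ->
    exec B (If x c1 c2) s (expr_cost x + t).+1 s'
| ExecWhileTrue x c s1 s2 s3 k t1 t2 :
    eval B s1 x = Some k.+1 -> exec B c s1 t1 s2 ->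
    exec B (While x c) s2 t2 s3 ->
    exec B (While x c) s1 (expr_cost x + t1 + t2).+1 s3
| ExecWhileFalse x c s :
    eval B s x = Some 0 -> exec B (While x c) s (expr_cost x).+1 s.

(* Vertices and colours are numbered by enum_rank.  Array 0 holds |V| and |C|,
   array 1 the adjacency matrix in row-major order, array 2 the colouring. *)
Definition input (V C : finType) (e : rel V) (w : {ffun V -> C}) : memory :=
  fun a i =>
    match a with
    | 0 => nth 0 [:: #|V|; #|C|] i
    | 1 => nth 0 [seq nat_of_bool (e u v) | u <- enum V, v <- enum V] i
    | 2 => nth 0 [seq nat_of_ord (enum_rank (w v)) | v <- enum V] i
    | _ => 0
    end.

(* The answers: m_G(G, w, d) in cell (number of d) of array 3 for every d, and
   m_G(G, w) in cell 0 of array 4. *)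
Definition correct_output (V C : finType) (e : rel V) (w : {ffun V -> C})
    (s : memory) : Prop :=
  (forall d : C, s 3 (enum_rank d) = min_moves_to e w d) /\
  s 4 0 = min_moves e w.

(* Main.v *)
(** A flooding of a connected vertex set [A] with colour [d] can be taken apart
from its last move.  If that move recolours all of [A], then [A] was flooded
with another colour one move earlier.  Otherwise it leaves some connected piece
of colour [d] untouched; no edge between this piece and the rest was ever
monochromatic, so the two sides were flooded independently.  Conversely two
adjacent disjoint pieces can be flooded at the sum of their costs: the laminar
family of recoloured sets can be rearranged, at no extra cost, so that a given
pair of adjacent vertices of equal initial colour always moves together, and
after contracting the monochromatic components the innermost set of the family
is a legal first move.  Hence the minimum is given by the rules
[m(A,d) <= m(A,d') + 1] and [m(A u B, d) <= m(A,d) + m(B,d)].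

The program lists the connected vertex sets (there are at most [N], since
distinct ones induce distinct connected subgraphs).  It joins any two known
ones that are disjoint and adjacent, looks the union up in a binary trie, and
records the at most [N^2] triples (A, B, A u B).  This takes time O(N^3).
Then 2|V| rounds of relaxing both rules over all triples and all pairs of
colours, O(|C|^2 N^3) steps, reach the minimum. *)

Require Import Defs.
From mathcomp Require Import all_boot zify.

Set Implicit Arguments.
Unset Strict Implicit.
Unset Printing Implicit Defensive.

(** * Derivations of floodings *)

(** The extent of a move is not fixed in advance: once pieces of [A] and [B] agree in colour across
    an edge, they move together, so two move sequences cannot simply be interleaved. Floodings are
    therefore compared with trees that carry no order in time. Joins in them are disjoint, so every
    recolouring acts on a prescribed set, and recolourings in different branches do not interfere.
    The leaves are an arbitrary predicate because playing or undoing a move changes the initial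
    colouring, hence only the sets that count as coloured for free. Trees over single vertices and
    trees over monochromatic blocks thus belong to one inductive type; passing from the former to
    the latter is the hard step.

    On the machine side the constraint is the word size. Every stored number is at most some [H] of
    order [|C| * N ^ 3], and expressions grow no faster than polynomials of degree 8 in [H], so
    words polynomial in [|C| * N] suffice. *)

Lemma disjoint_setUr (T : finType) (A B D : {set T}) :
  [disjoint D & A :|: B] = [disjoint D & A] && [disjoint D & B].
Proof. by rewrite -!setI_eq0 setIUr setU_eq0. Qed.

Lemma disjoint_setUl (T : finType) (A B D : {set T}) :
  [disjoint A :|: B & D] = [disjoint A & D] && [disjoint B & D].
Proof. by rewrite -!setI_eq0 setIUl setU_eq0. Qed.

Section Derivations.
Variables (V C : finType) (e : rel V).
Hypothesis e_sym : symmetric e.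
Implicit Types (A B X Y Z : {set V}) (a c d : C) (w : {ffun V -> C}) (k j : nat).

Definition adj A B := exists x y, [/\ x \in A, y \in B & e x y].

Lemma adjS A B A' B' : A \subset A' -> B \subset B' -> adj A B -> adj A' B'.
Proof.
by move=> /subsetP sA /subsetP sB [x [y [/sA ? /sB ? ?]]]; exists x, y.
Qed.

Lemma adjC A B : adj A B -> adj B A.
Proof. by move=> [x [y [? ? exy]]]; exists y, x; rewrite e_sym. Qed.

(* [L A d] are the sets that count as having colour [d] from the start; [k] is
   the number of recolourings. *)
Inductive deriv (L : {set V} -> C -> Prop) : {set V} -> C -> nat -> Prop :=
| DLeaf A d : L A d -> deriv L A d 0
| DRecolour A d c k : deriv L A d k -> deriv L A c k.+1
| DJoin A B d k j : deriv L A d k -> deriv L B d j -> [disjoint A & B] ->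
    adj A B -> deriv L (A :|: B) d (k + j).

(** A derivation of [A] uses only leaves inside [A], so only these have to be replaced. *)
Lemma deriv_leaves (L L' : {set V} -> C -> Prop) A d k :
  (forall Z a, Z \subset A -> L Z a -> deriv L' Z a 0) ->
  deriv L A d k -> deriv L' A d k.
Proof.
move=> LL' D; elim: D LL' => {A d k} [A d LA|A d c k _ IH|A B d k j _ IHA _ IHB dAB adAB] LL'.
- exact: LL'.
- by apply: DRecolour (IH LL').
- apply: DJoin => //; [apply: IHA|apply: IHB] => Z a sZ; apply: LL'.
  + exact: subset_trans sZ (subsetUl _ _).
  + exact: subset_trans sZ (subsetUr _ _).
Qed.

(** * Merging two adjacent leaves of equal colour *)

Section Contract.
Variables (L L' : {set V} -> C -> Prop) (a : C).

(* In a derivation of [A] with leaf [X], the leaf may be replaced by any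
   derivation, ending in the same colour, of a set containing [X]. *)
Definition pluggable X A c k := forall Z j, X \subset Z ->
  [disjoint Z & A :\: X] -> deriv L' Z a j -> deriv L' (A :|: Z) c (k + j).

(** Makes [X] an atom for [L]: every derived set contains or avoids it. Since joins are disjoint, a
    derivation uses such a leaf at most once. *)
Definition leaf_block X := (forall Z b, L Z b -> Z = X \/ [disjoint X & Z]) /\
  (forall b, L X b -> b = a) /\ X != set0.

Lemma block_in X A d k : leaf_block X -> deriv L A d k ->
  X \subset A \/ [disjoint X & A].
Proof.
move=> [HX _]; elim=> {A d k} [A d /HX [->|]|//|A B d k j _ IHA _ IHB _ _]; auto.
case: IHA => [sA|dA]; first by left; apply: subset_trans sA (subsetUl _ _).
case: IHB => [sB|dB]; first by left; apply: subset_trans sB (subsetUr _ _).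
by right; rewrite disjoint_setUr dA.
Qed.

Variables X Y : {set V}.
Hypotheses (bX : leaf_block X) (bY : leaf_block Y) (dXY : [disjoint X & Y]).
Hypothesis L'U : L' (X :|: Y) a.
Hypothesis L'o : forall Z b, L Z b -> Z <> X -> Z <> Y -> L' Z b.

Lemma block_nsub T A : leaf_block T -> T \subset A -> [disjoint T & A] -> False.
Proof.
move=> [_ [_ /set0Pn[x xT]]] /subsetP/(_ x xT) xA /disjoint_setI0/setP/(_ x).
by rewrite !inE xT xA.
Qed.

Lemma block_join T A B d k j : leaf_block T -> deriv L A d k -> deriv L B d j ->
  T \subset A :|: B -> [disjoint A & B] ->
  (T \subset A /\ [disjoint T & B]) \/ (T \subset B /\ [disjoint T & A]).
Proof.
move=> bT DA DB sT dAB.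
case: (block_in bT DA) => [sA|dA]; case: (block_in bT DB) => [sB|dB]; auto.
  by case: (block_nsub bT sB); apply: disjointWl sA dAB.
by case: (block_nsub bT sT); rewrite disjoint_setUr dA.
Qed.

Lemma deriv_avoid A d k : deriv L A d k -> [disjoint X & A] ->
  [disjoint Y & A] -> deriv L' A d k.
Proof.
move=> D dX dY; apply: deriv_leaves D => Z b sZ LZ.
apply: DLeaf; apply: L'o => // eZ; subst Z.
  exact: (block_nsub bX sZ dX).
exact: (block_nsub bY sZ dY).
Qed.

(** Every join on the way up from the leaf [T] is repeated with the side of [T] enlarged by [Z];
    that [Z] avoids [A :\: T] keeps these joins disjoint. Here and below [T] and [T'] stand for [X]
    and [Y] in either order, which is why [avoid] is a hypothesis. *)
Lemma deriv_plug T T' A d k : leaf_block T -> leaf_block T' ->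
  (forall B c j, deriv L B c j -> [disjoint T & B] -> [disjoint T' & B] ->
     deriv L' B c j) ->
  deriv L A d k -> T \subset A -> [disjoint T' & A] -> pluggable T A d k.
Proof.
move=> bT bT' avoid; elim=> {A d k} [A d LA|A d c k _ IH|A B d k j DA IHA DB IHB dAB adAB] sT dT' Z l sZ dZ DZ.
- case: (bT.1 _ _ LA) => [eA|/(block_nsub bT sT)//]; subst A.
  by rewrite (bT.2.1 _ LA) add0n (setUidPr sZ).
- by apply: DRecolour; apply: IH.
- move: dT'; rewrite disjoint_setUr => /andP[dA dB].
  have /andP[dZA dZB]: [disjoint Z & A :\: T] && [disjoint Z & B :\: T].
    by rewrite -disjoint_setUr -setDUl.
  case: (block_join bT DA DB sT dAB) => [[sTA dTB]|[sTB dTA]].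
  + rewrite setUAC addnAC; apply: DJoin.
    * exact: IHA.
    * exact: avoid.
    * rewrite disjoint_setUl dAB; move: dZB; rewrite (_ : B :\: T = B) //.
      by apply/setDidPl; rewrite disjoint_sym.
    * by apply: adjS adAB => //; apply: subsetUl.
  + rewrite -setUA -addnA; apply: DJoin.
    * exact: avoid.
    * exact: IHB.
    * rewrite disjoint_setUr dAB disjoint_sym; move: dZA; rewrite (_ : A :\: T = A) //.
      by apply/setDidPl; rewrite disjoint_sym.
    * by apply: adjS adAB => //; apply: subsetUl.
Qed.

(** Two pluggings: the merged leaf [T :|: T'] takes the place of [T'] in the derivation of [B],
    which again ends in [a]; the result takes the place of [T] in the derivation of [A]. *)
Lemma deriv_link_leaf T T' A B c k j : leaf_block T -> leaf_block T' ->
  (forall B c j, deriv L B c j -> [disjoint T & B] -> [disjoint T' & B] ->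
     deriv L' B c j) ->
  L' (T :|: T') a -> pluggable T A c k -> T \subset A ->
  deriv L B a j -> T' \subset B -> [disjoint A & B] ->
  deriv L' (A :|: B) c (k + j).
Proof.
move=> bT bT' avoid LU plugA sT DB sT' dAB.
have dTB : [disjoint T & B] by apply: disjointWl dAB.
have avoid' D b l : deriv L D b l ->
    [disjoint T' & D] -> [disjoint T & D] -> deriv L' D b l.
  by move=> DD dD dD'; apply: avoid.
have := deriv_plug bT' bT avoid' DB sT' dTB (subsetUr T T') _ (DLeaf LU).
rewrite setDE disjoint_setUl.
rewrite (disjointWr (subsetIl _ _) dTB) -setDE -setI_eq0.
have -> : T' :&: (B :\: T') = set0 by apply/setP => x; rewrite !inE; case: (x \in T').
rewrite eqxx addn0 => /(_ isT) DBT.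
have -> : A :|: B = A :|: (B :|: (T :|: T')).
  rewrite -{1}(setUidPl sT) -{1}(setUidPl sT').
  by apply/setP => x; rewrite !inE; do !case: (x \in _).
apply: plugA => //; first by apply/subsetP => x xT; rewrite !inE xT orbT.
rewrite -setI_eq0; apply/eqP/setP => x; rewrite !inE.
case xA: (x \in A); last by rewrite andbF andbF.
have -> : x \in B = false.
  by apply/negP => xB; move/disjoint_setI0/setP/(_ x): dAB; rewrite !inE xA xB.
have -> : x \in T' = false.
  apply/negP => /(subsetP sT') xB.
  by move/disjoint_setI0/setP/(_ x): dAB; rewrite !inE xA xB.
by rewrite orbF andbT; case: (x \in T).
Qed.

(* As [d != a], some recolouring of [T'] away from [a] occurs in the derivation
   of [B]; the whole derivation of [A] is carried out just before it. *)
Lemma deriv_link T T' A B c d k j : leaf_block T -> leaf_block T' ->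
  (forall B c j, deriv L B c j -> [disjoint T & B] -> [disjoint T' & B] ->
     deriv L' B c j) ->
  L' (T :|: T') a -> pluggable T A c k -> T \subset A ->
  deriv L B d j -> T' \subset B -> [disjoint A & B] -> d != a ->
  deriv L' (A :|: B) d (k + j).
Proof.
move=> bT bT' avoid LU plug sTA DB; have avoid' D b l : deriv L D b l ->
    [disjoint T' & D] -> [disjoint T & D] -> deriv L' D b l.
  by move=> DD dD dD'; apply: avoid.
elim: DB => {B d j} [B d LB|B d c' j DB IH|B D d j l DB IHB DD IHD dBD adBD] sT' dAB.
- case: (bT'.1 _ _ LB) => [eB|/(block_nsub bT' sT')//]; subst B.
  by rewrite (bT'.2.1 _ LB) eqxx.
- move=> _; rewrite addnS.
  have [ed|nd] := eqVneq d a; last by apply: DRecolour; apply: IH.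
  (* The recolouring of [B] away from [a] is replaced by one of all of [A :|: B], so the costs still
     just add up. *)
  subst d; apply: (@DRecolour _ _ c); exact: (deriv_link_leaf bT bT').
- move=> nd; move: dAB; rewrite disjoint_setUr => /andP[dAB dAD].
  case: (block_join bT' DB DD sT' dBD) => [[sB dD]|[sD dB]].
  + rewrite setUA addnA; apply: DJoin; first exact: IHB.
    * by apply: avoid => //; apply: disjointWl dAD.
    * by rewrite disjoint_setUl dAD.
    * by apply: adjS adBD => //; apply: subsetUr.
  + rewrite (setUC B) setUA (addnC j) addnA; apply: DJoin; first exact: IHD.
    * by apply: avoid => //; apply: disjointWl dAB.
    * by rewrite disjoint_setUl dAB disjoint_sym.
    * by apply: adjS (adjC adBD) => //; apply: subsetUr.
Qed.

Lemma deriv_link_same T T' A B d k j : leaf_block T -> leaf_block T' ->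
  [disjoint T & T'] ->
  (forall B c j, deriv L B c j -> [disjoint T & B] -> [disjoint T' & B] ->
     deriv L' B c j) ->
  L' (T :|: T') a -> deriv L A d k -> T \subset A -> [disjoint T' & A] ->
  deriv L B d j -> T' \subset B -> [disjoint A & B] ->
  deriv L' (A :|: B) d (k + j).
Proof.
move=> bT bT' dTT avoid LU DA sT dT' DB sT' dAB.
have plugA := deriv_plug bT bT' avoid DA sT dT'.
have [ed|nd] := eqVneq d a; last by apply: deriv_link LU plugA _ DB _ _ _.
subst d; exact: (deriv_link_leaf bT bT').
Qed.

(* [L'] is [L] with the adjacent leaves [X] and [Y], of the same colour, merged
   into one: the cost does not change. *)
Lemma deriv_contract A d k : deriv L A d k -> X \subset A -> Y \subset A ->
  deriv L' A d k.
Proof.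
have avoid B c j : deriv L B c j -> [disjoint X & B] -> [disjoint Y & B] ->
    deriv L' B c j by exact: deriv_avoid.
have avoid' B c j : deriv L B c j -> [disjoint Y & B] -> [disjoint X & B] ->
    deriv L' B c j by move=> ? ? ?; apply: deriv_avoid.
elim=> {A d k} [A d LA|A d c k _ IH|A B d k j DA IHA DB IHB dAB adAB] sX sY.
- case: (bX.1 _ _ LA) => [eA|/(block_nsub bX sX)//]; subst A.
  by case: (block_nsub bY sY); rewrite disjoint_sym.
- by apply: DRecolour; apply: IH.
- case: (block_join bX DA DB sX dAB) => -[sX' dX'];
  case: (block_join bY DA DB sY dAB) => -[sY' dY'].
  + by apply: DJoin => //; [apply: IHA | apply: avoid].
  + exact: (deriv_link_same bX bY).
  + by apply: (deriv_link_same bY bX) => //; rewrite 1?disjoint_sym // setUC.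
  + by apply: DJoin => //; [apply: avoid | apply: IHB].
Qed.

End Contract.

(** * From single vertices to the classes of a relation *)

Definition single w A d := exists v, A = [set v] /\ d = w v.

Definition block_leaf (P : {set {set V}}) w X a :=
  X \in P /\ {in X, forall x, w x = a}.

Definition class (r : rel V) v := [set u | connect r v u].

Definition class_leaf r w X a := exists v, X = class r v /\ a = w v.

(** A partition lying between the singletons and the classes of [r]; blocks are merged along edges
    of [r] until they are classes. *)
Definition blocks (r : rel V) (P : {set {set V}}) :=
  [/\ {in P &, forall X Y, X != Y -> [disjoint X & Y]},
      forall v, exists2 X, X \in P & v \in X &
      {in P, forall X, X != set0 /\ {in X &, forall x y, connect r x y}}].

Definition merge_blocks (P : {set {set V}}) X Y := (X :|: Y) |: (P :\ X :\ Y).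

Section Saturate.
Variables (r : rel V) (w : {ffun V -> C}).
Hypothesis rsym : symmetric r.
Hypothesis re : forall x y, r x y -> e x y /\ w x = w y.

Lemma connect_colour x y : connect r x y -> w x = w y.
Proof.
case/connectP=> p; elim: p x => [x _ -> //|z p IH x /= /andP[/re[_ ->] pz] ly].
exact: IH ly.
Qed.

Lemma merge_blocksP P X Y x y : blocks r P -> X \in P -> Y \in P -> X != Y ->
  x \in X -> y \in Y -> r x y ->
  blocks r (merge_blocks P X Y) /\ #|merge_blocks P X Y| < #|P|.
Proof.
move=> [dP cP nP] XP YP nXY xX yY rxy; split; last first.
  rewrite (cardsD1 X P) XP (cardsD1 Y (P :\ X)) !inE YP eq_sym nXY /=.
  by rewrite cardsU1; case: (_ \notin _).
have dU Z : Z \in P -> Z != X -> Z != Y -> [disjoint X :|: Y & Z].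
  by move=> ZP ZX ZY; rewrite disjoint_setUl !dP // eq_sym.
split.
- move=> Z T; rewrite !inE => /orP[/eqP ->|/and3P[ZY ZX ZP]] /orP[/eqP ->|/and3P[TY TX TP]].
  + by rewrite eqxx.
  + by move=> _; apply: dU.
  + by move=> _; rewrite disjoint_sym; apply: dU.
  + exact: dP.
- move=> v; have [Z ZP vZ] := cP v.
  case ZX: (Z == X); last case ZY: (Z == Y).
  + by exists (X :|: Y); rewrite !inE ?eqxx // -(eqP ZX) vZ.
  + by exists (X :|: Y); rewrite !inE ?eqxx // -(eqP ZY) vZ orbT.
  + by exists Z; rewrite // !inE ZX ZY ZP orbT.
- move=> Z; rewrite !inE => /orP[/eqP ->|/and3P[_ _ /nP //]]; split.
    by apply/set0Pn; exists x; rewrite inE xX.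
  have cX := (nP X XP).2; have cY := (nP Y YP).2.
  have cs := @sym_connect_sym _ r rsym.
  have cXY u v : u \in X -> v \in Y -> connect r u v.
    move=> uX vY; apply: connect_trans (cX u x uX xX) _.
    by apply: connect_trans (connect1 rxy) (cY y v yY vY).
  move=> u v; rewrite !inE => /orP[uX|uY] /orP[vX|vY]; auto.
  by rewrite cs; apply: cXY.
Qed.

Lemma deriv_merge P X Y x y d k : blocks r P -> X \in P -> Y \in P -> X != Y ->
  x \in X -> y \in Y -> r x y -> deriv (block_leaf P w) setT d k ->
  deriv (block_leaf (merge_blocks P X Y) w) setT d k.
Proof.
move=> [dP cP nP] XP YP nXY xX yY rxy D.
have bl Z z : Z \in P -> z \in Z -> leaf_block (block_leaf P w) (w z) Z.
  move=> ZP zZ; split=> [T b [TP _]|].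
    by case eZ: (Z == T); [left; apply/esym/eqP | right; apply: dP; rewrite ?eZ].
  by split=> [b [_ /(_ z zZ) ->]|] //; apply: (nP Z ZP).1.
have ew := (re rxy).2.
apply: (@deriv_contract (block_leaf P w) _ (w x) X Y); rewrite ?subsetT //.
- exact: bl.
- by rewrite ew; apply: bl.
- exact: dP.
- split; first by rewrite !inE eqxx.
  move=> z; rewrite inE => /orP[zX|zY].
    by apply: connect_colour; apply: (nP X XP).2.
  by rewrite ew; apply: connect_colour; apply: (nP Y YP).2.
- move=> Z b [ZP Zb] /eqP ZX /eqP ZY; split=> //.
  by rewrite !inE ZP ZX ZY orbT.
Qed.

(** Each merge lowers the number of blocks. When no edge of [r] joins two blocks any more, no path
    of [r] leaves a block, so every block is a full class. *)
Lemma blocks_saturate P d k : blocks r P -> deriv (block_leaf P w) setT d k ->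
  deriv (class_leaf r w) setT d k.
Proof.
have [m] := ubnP #|P|; elim: m P => // m IH P Pm bP D.
case: (boolP [exists X in P, exists Y in P, [exists x in X, [exists y in Y,
  (X != Y) && r x y]]]) => [/exists_inP[X XP /exists_inP[Y YP]]|sat].
  move=> /exists_inP[x xX /exists_inP[y yY /andP[nXY rxy]]].
  have [bP' cP'] := merge_blocksP bP XP YP nXY xX yY rxy.
  apply: IH bP' _; first by apply: leq_trans cP' _.
  exact: deriv_merge xX yY rxy D.
apply: deriv_leaves D => Z a _ [ZP Za]; apply: DLeaf.
have [/set0Pn[z zZ] cZ] := (let: And3 _ _ nP := bP in nP Z ZP).
exists z; split; last by rewrite Za.
apply/setP => u; rewrite inE; apply/idP/idP => [uZ|]; first exact: cZ.
case/connectP=> p; elim: p z zZ => [z zZ _ -> //|t p IHp z zZ /= /andP[rzt pt] lu].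
apply: IHp pt lu; have [_ cP _] := bP; have [T TP tT] := cP t.
have [->//|nZT] := eqVneq Z T.
case/negP: sat; apply/exists_inP; exists Z => //; apply/exists_inP; exists T => //.
apply/exists_inP; exists z => //; apply/exists_inP; exists t => //.
by rewrite nZT.
Qed.

(** The relation [r] is left general because it is used twice: with all monochromatic edges, to find
    a first move, and with the edges inside one recoloured component only, to undo a move. Deriving
    [setT] ensures that the blocks to be merged lie in the derived set. *)
Lemma deriv_saturate d k : deriv (single w) setT d k ->
  deriv (class_leaf r w) setT d k.
Proof.
move=> D; apply: (@blocks_saturate [set [set v] | v : V]).
  split.
  - move=> X Y /imsetP[x _ ->] /imsetP[y _ ->] nxy.
    by rewrite disjoints1 inE; apply: contraNN nxy => /eqP ->.
  - by move=> v; exists [set v]; rewrite ?set11 // imset_f.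
  - move=> X /imsetP[x _ ->]; split; first by apply/set0Pn; exists x; rewrite set11.
    by move=> y z /set1P -> /set1P ->.
apply: deriv_leaves D => Z a _ [v [-> ->]]; apply: DLeaf; split.
  exact: imset_f.
by move=> x /set1P ->.
Qed.

(* Grow the class one vertex at a time, along the edges of [r]. *)
Lemma deriv_class v : deriv (single w) (class r v) (w v) 0.
Proof.
have D1 : deriv (single w) [set v] (w v) 0 by apply: DLeaf; exists v.
suff H A : v \in A -> A \subset class r v -> deriv (single w) A (w v) 0 ->
    deriv (single w) (class r v) (w v) 0.
  by apply: H D1; rewrite ?set11 // sub1set inE connect0.
have [m] := ubnP (#|class r v| - #|A|); elim: m A => // m IH A Am vA sA DA.
have [<-//|nA] := eqVneq A (class r v).
have pA : A \proper class r v by rewrite properEneq nA.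
have [x xA [y yA rxy]] : exists2 x, x \in A & exists2 y, y \notin A & r x y.
  have [_ [u]] := properP pA; rewrite inE => /connectP[p pp ->].
  elim: p v vA pp {sA DA nA pA IH Am D1} => [z zA _ /negP[]//|t p IHp z zA /= /andP[rzt pt] lA].
  case tA: (t \in A); first exact: IHp pt lA.
  by exists z => //; exists t; rewrite ?tA.
have yc : y \in class r v.
  by move/subsetP/(_ x xA): sA; rewrite !inE => /connect_trans; apply; apply: connect1.
apply: (IH (A :|: [set y])).
- have lA : #|A| < #|class r v| by apply: proper_card.
  by rewrite setUC cardsU1 yA; move: lA Am; rewrite !ltnS; clear; lia.
- by rewrite inE vA.
- by rewrite subUset sA sub1set.
- apply: (@DJoin _ _ _ _ 0 0) => //.
  + apply: DLeaf; exists y; split=> //; apply: connect_colour.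
    by move: yc; rewrite inE.
  + by rewrite disjoint_sym disjoints1.
  + by exists x, y; split; rewrite ?set11 //; apply: (re rxy).1.
Qed.

End Saturate.

Lemma class_eq (r : rel V) u v : symmetric r -> u \in class r v ->
  class r u = class r v.
Proof.
move=> rsym; rewrite inE => vu; apply/setP => x; rewrite !inE.
by rewrite (same_connect (sym_connect_sym rsym) vu).
Qed.

Lemma class_disjoint (r : rel V) u v : symmetric r ->
  class r u = class r v \/ [disjoint class r u & class r v].
Proof.
move=> rsym; case: (boolP [disjoint class r u & class r v]); first by right.
rewrite -setI_eq0 => /set0Pn[x]; rewrite in_setI => /andP[xu xv]; left.
by rewrite -(class_eq rsym xu) (class_eq rsym xv).
Qed.

(** * Derivations and move sequences *)

Definition mono_rel w : rel V := fun x y => e x y && (w x == w y).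

Lemma mono_rel_sym w : symmetric (mono_rel w).
Proof. by move=> x y; rewrite /mono_rel e_sym eq_sym. Qed.

Lemma mono_relP w x y : mono_rel w x y -> e x y /\ w x = w y.
Proof. by case/andP=> -> /eqP. Qed.

Lemma play_moveE w v c u :
  play_move e w (v, c) u = if u \in class (mono_rel w) v then c else w u.
Proof. by rewrite ffunE. Qed.

Definition recoloured_leaf r w X c Z b :=
  (class_leaf r w Z b /\ Z != X) \/ (Z = X /\ b = c).

(** Adjacent classes of equal colour coincide, so two untouched leaves are never joined. Hence an
    innermost recolouring acts on a single class and is a legal move; after it, that class is a leaf
    of the new colour. *)
Lemma first_move w A d k : deriv (class_leaf (mono_rel w) w) A d k ->
  (k = 0 /\ class_leaf (mono_rel w) w A d) \/
  exists v c j, [/\ class (mono_rel w) v \subset A, k = j.+1 &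
    deriv (recoloured_leaf (mono_rel w) w (class (mono_rel w) v) c) A d j].
Proof.
set r := mono_rel w; have rsym : symmetric r := mono_rel_sym w.
have lift B b j v c : deriv (class_leaf r w) B b j -> [disjoint class r v & B] ->
    deriv (recoloured_leaf r w (class r v) c) B b j.
  move=> DB dB; apply: deriv_leaves DB => Z a sZ LZ; apply: DLeaf; left; split=> //.
  apply/eqP => eZ; move: (disjointWr sZ dB); rewrite eZ -setI_eq0 setIid.
  by move/eqP/setP/(_ v); rewrite !inE connect0.
elim=> {A d k} [A d LA|A d c k D IH|A B d k j DA IHA DB IHB dAB adAB].
- by left.
- right; case: IH => [[k0 [v [eA ed]]]|[v [b [j [sX ek D']]]]].
    by exists v, c, 0; rewrite k0 -eA; split=> //; apply: DLeaf; right.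
  by exists v, b, j.+1; rewrite -ek; split=> //; rewrite ek; apply: DRecolour D'.
- case: IHA => [[k0 LA]|[v [b [l [sX ek D']]]]]; last first.
    right; exists v, b, (l + j); rewrite ek; split=> //.
      exact: subset_trans sX (subsetUl _ _).
    by apply: DJoin => //; apply: lift => //; apply: disjointWl dAB.
  case: IHB => [[j0 LB]|[v [b [l [sX ek D']]]]]; last first.
    right; exists v, b, (k + l); rewrite ek addnS; split=> //.
      exact: subset_trans sX (subsetUr _ _).
    by apply: DJoin => //; apply: lift => //; rewrite disjoint_sym; apply: disjointWr dAB.
  case: LA LB => [u [eA edu]] [v [eB edv]]; case: adAB => [x [y [xA yB exy]]].
  have wx : w x = d.
    rewrite edu; apply/esym/(connect_colour (@mono_relP w)).
    by move: xA; rewrite eA inE.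
  have wy : w y = d.
    rewrite edv; apply/esym/(connect_colour (@mono_relP w)).
    by move: yB; rewrite eB inE.
  have : y \in A.
    rewrite eA -(@class_eq _ x) //; last by rewrite -eA.
    by rewrite inE; apply: connect1; rewrite /r /mono_rel exy wx wy eqxx.
  by move=> yA; move/disjoint_setI0/setP/(_ y): dAB; rewrite !inE yA yB.
Qed.

Lemma play_of_deriv w d k : deriv (single w) setT d k -> floodable_in e w d k.
Proof.
suff H : deriv (single w) setT d k -> exists2 s, size s == k & play e w s = [ffun=> d].
  by move=> /H[s sk ps]; apply/existsP; exists (Tuple sk); apply/eqP.
elim: k w => [|k IH] w D0.
- have D := deriv_saturate (mono_rel_sym w) (@mono_relP w) D0.
  case: (first_move D) => [[_ [v [eT ed]]]|[? [? [? []]]] //].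
  exists [::] => //; apply/ffunP => u; rewrite /= ffunE ed.
  apply/esym/(connect_colour (@mono_relP w)).
  by move: (in_setT u); rewrite eT inE.
- have D := deriv_saturate (mono_rel_sym w) (@mono_relP w) D0.
  case: (first_move D) => [[]//|[v [c [j [_ [<-] D1]]]]].
  have [|s ss ps] := IH (play_move e w (v, c)); last by exists ((v, c) :: s).
  apply: deriv_leaves D1 => Z b _.
  (* The move recolours a component as a whole, so edges that were monochromatic remain so, and the
     old classes are still assembled at no cost under the new colouring. *)
  have rw x y : mono_rel w x y -> e x y /\ play_move e w (v, c) x = play_move e w (v, c) y.
    move=> rxy; rewrite !play_moveE (mono_relP rxy).2; split; first exact: (mono_relP rxy).1.
    by rewrite !inE (same_connect_r (sym_connect_sym (mono_rel_sym w)) (connect1 rxy)).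
  case=> [[[u [-> ->]] nX]|[-> ->]].
    have -> : w u = play_move e w (v, c) u.
      rewrite play_moveE; case: ifP => // uX.
      by case/eqP: nX; apply: class_eq => //; apply: mono_rel_sym.
    exact: deriv_class.
  by have := deriv_class rw v; rewrite play_moveE inE connect0.
Qed.

(** The leaf [X] occurs only once in the derivation, so the cost 1 of its replacement is paid only
    once. *)
Lemma deriv_subst (L L' : {set V} -> C -> Prop) a X A d k : leaf_block L a X ->
  (forall Z b, L Z b -> Z <> X -> deriv L' Z b 0) -> deriv L' X a 1 ->
  deriv L A d k -> X \subset A -> deriv L' A d k.+1.
Proof.
move=> bX L'o L'X; have avoid B b j : deriv L B b j -> [disjoint X & B] -> deriv L' B b j.
  move=> D dX; apply: deriv_leaves D => Z c sZ LZ.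
  by apply: L'o => // eZ; subst Z; apply: (block_nsub bX sZ dX).
elim=> {A d k} [A d LA|A d c k _ IH|A B d k j DA IHA DB IHB dAB adAB] sX.
- case: (bX.1 _ _ LA) => [eA|/(block_nsub bX sX)//]; subst A.
  by rewrite (bX.2.1 _ LA).
- by apply: DRecolour; apply: IH.
- case: (block_join bX DA DB sX dAB) => -[sX' dX'].
    by rewrite -addSn; apply: DJoin => //; [apply: IHA | apply: avoid].
  by rewrite -addnS; apply: DJoin => //; [apply: avoid | apply: IHB].
Qed.

(** The first move is undone in the derivation for the colouring after it: once the recoloured
    component has been contracted to a single leaf, one recolouring produces that leaf from the
    original colouring. *)
Lemma deriv_of_play w d s : graph_connected e -> play e w s = [ffun=> d] ->
  exists2 k, k <= size s & deriv (single w) setT d k.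
Proof.
move=> /andP[/card_gt0P[v0 _] /forallP ce]; elim: s w => [|[v c] s IH] w /= ps.
  have wd x : w x = d by rewrite ps ffunE.
  exists 0 => //; have := deriv_class (@mono_relP w) v0.
  rewrite wd; have -> // : class (mono_rel w) v0 = setT.
  apply/setP => x; rewrite !inE; have /forallP/(_ x) := ce v0.
  by apply: connect_sub => y z eyz; apply: connect1; rewrite /mono_rel eyz !wd eqxx.
have [k ks D] := IH _ ps; exists k.+1 => //.
set w' := play_move e w (v, c) in ps D; set X := class (mono_rel w) v.
have w'X x : x \in X -> w' x = c by rewrite /w' play_moveE => ->.
have w'o x : x \notin X -> w' x = w x by rewrite /w' play_moveE => /negbTE ->.
(* Only edges inside [X] are contracted: the other leaves stay single vertices, on which [w'] and
   [w] agree. *)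
pose r : rel V := fun x y => [&& e x y, x \in X & y \in X].
have rsym : symmetric r by move=> x y; rewrite /r e_sym [(y \in X) && _]andbC.
have re x y : r x y -> e x y /\ w' x = w' y.
  by case/and3P=> ? xX yX; rewrite !w'X.
have vX : v \in X by rewrite inE connect0.
have rv : class r v = X.
  apply/setP => x; apply/idP/idP.
    rewrite inE => /connectP[p pp ->]; elim/last_ind: p pp => // p t _.
    by rewrite rcons_path last_rcons => /andP[_ /and3P[]].
  rewrite inE => /connectP[p pp ->]; rewrite inE.
  elim/last_ind: p pp => [_|p t IHp]; first exact: connect0.
  rewrite rcons_path last_rcons => /andP[pp rt]; apply: connect_trans (IHp pp) _.
  have lX : last v p \in X by rewrite inE; apply/connectP; exists p.
  apply: connect1; rewrite /r (mono_relP rt).1 lX inE /=.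
  by move: lX; rewrite inE => /connect_trans; apply; apply: connect1.
have ro x : x \notin X -> class r x = [set x].
  move=> xX; apply/setP => y; rewrite !inE; apply/idP/eqP => [|->]; last exact: connect0.
  by case/connectP=> -[_ -> //|z p /=]; rewrite /r (negbTE xX) andbF.
have := deriv_saturate rsym re D; move/(@deriv_subst _ (single w) c X); apply.
- split; [|split].
  + move=> Z b [u [-> _]]; rewrite -rv; case: (class_disjoint v u rsym); auto.
  + by move=> b [u [eX ->]]; apply: w'X; rewrite eX inE connect0.
  + by apply/set0Pn; exists v.
- move=> Z b [u [-> ->]] nX; case uX: (u \in X).
    by case: nX; rewrite -rv; apply: class_eq => //; rewrite rv.
  rewrite ro ?uX // w'o ?uX //; apply: DLeaf; by exists u.
- apply: (@DRecolour _ _ (w v)).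
  exact: (deriv_class (@mono_relP w)).
- exact: subsetT.
Qed.

Lemma min_moves_deriv w d k : graph_connected e -> deriv (single w) setT d k ->
  (forall j, deriv (single w) setT d j -> k <= j) -> k = min_moves_to e w d.
Proof.
move=> ce D kmin; rewrite /min_moves_to; case: ex_minnP => m /existsP[s /eqP ps] mmin.
have [j js Dj] := deriv_of_play ce ps; rewrite size_tuple in js.
apply/eqP; rewrite eqn_leq (leq_trans (kmin _ Dj) js) /=.
by apply: mmin; apply: play_of_deriv.
Qed.

Lemma deriv_exists w d : graph_connected e -> exists k, deriv (single w) setT d k.
Proof.
move=> ce; have /existsP[s /eqP ps] := floodable_card e w d.
by have [k _ D] := deriv_of_play ce ps; exists k.
Qed.

(** * Connected vertex sets *)

Definition induced A : {set V} * {set {set V}} := (A, [set f in edges e | f \subset A]).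

Definition cset A := connected_subgraph e (induced A).

Lemma card_csets : #|[set A | cset A]| <= num_connected_subgraphs e.
Proof.
rewrite -(card_imset _ (_ : injective induced)); last by move=> A B [].
apply: subset_leq_card; apply/subsetP => H /imsetP[A]; rewrite !inE => cA ->.
exact: cA.
Qed.

Lemma csetP A : reflect (A != set0 /\
    {in A &, forall x y, connect (fun u v => [set u; v] \in (induced A).2) x y})
  (cset A).
Proof.
apply: (iffP and3P) => [[_ ? c]|[nA c]]; split=> //.
- by move=> x y xA yA; move/forall_inP/(_ x xA)/forall_inP/(_ y yA): c.
- apply/andP; split; first by apply/subsetP => f; rewrite !inE => /andP[].
  by apply/forall_inP => f; rewrite !inE => /andP[].
- by apply/forall_inP => x xA; apply/forall_inP => y yA; apply: c.
Qed.

Lemma cset1 v : cset [set v].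
Proof.
apply/csetP; split; first by apply/set0Pn; exists v; rewrite set11.
by move=> x y /set1P -> /set1P ->.
Qed.

Lemma csetU A B : cset A -> cset B -> adj A B -> cset (A :|: B).
Proof.
move=> /csetP[nA cA] /csetP[nB cB] [x [y [xA yB exy]]]; apply/csetP; split.
  by apply/set0Pn; exists x; rewrite inE xA.
have mono (D : {set V}) : D \subset A :|: B -> forall u v,
    connect (fun u v => [set u; v] \in (induced D).2) u v ->
    connect (fun u v => [set u; v] \in (induced (A :|: B)).2) u v.
  move=> sD u v; apply: connect_sub => s t; rewrite !inE => /andP[es st].
  by apply: connect1; rewrite !inE es (subset_trans st).
set r := (fun u v => _) in mono *.
have rsym : symmetric r by move=> u v; rewrite /r setUC.
have cAB u v : u \in A -> v \in B -> connect r u v.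
  move=> uA vB; apply: connect_trans (mono _ (subsetUl _ _) _ _ (cA u x uA xA)) _.
  apply: connect_trans (mono _ (subsetUr _ _) _ _ (cB y v yB vB)).
  apply: connect1; rewrite /r !inE; apply/andP; split.
    by apply/existsP; exists x; apply/existsP; exists y; rewrite exy eqxx.
  by apply/subsetP => z; rewrite !inE => /orP[/eqP ->|/eqP ->]; rewrite ?xA ?yB ?orbT.
move=> u v; rewrite !inE => /orP[uA|uB] /orP[vA|vB].
- exact: mono (subsetUl _ _) _ _ (cA u v uA vA).
- exact: cAB.
- by rewrite (sym_connect_sym rsym); apply: cAB.
- exact: mono (subsetUr _ _) _ _ (cB u v uB vB).
Qed.

End Derivations.

(** * Reasoning about programs *)

Section Logic.

(** The value without overflow checks. By [eval_den] the checks never fail for tame expressions in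
    bounded memories, so program proofs can reason with [den] alone. *)
Fixpoint den (s : memory) (x : expr) : nat :=
  match x with
  | Const k => k
  | Cell a i => s a (den s i)
  | Bin o y z => binop_sem o (den s y) (den s z)
  end.

(* If every memory cell is at most [H], then [x] and all its subexpressions are
   at most [H ^ degree x], so evaluation never exceeds the word size. *)
Fixpoint degree (x : expr) : nat :=
  match x with
  | Const _ | Cell _ _ => 1
  | Bin Defs.Sub y _ => degree y
  | Bin _ y z => degree y + degree z
  end.

(** Words must reach beyond [H ^ max_degree], so this number enters the exponent of the word size in
    the theorem. *)
Definition max_degree := 8.

Fixpoint tame (x : expr) : bool :=
  match x with
  | Const k => k <= 2
  | Cell _ i => tame i
  | Bin _ y z => [&& tame y, tame z & degree x <= max_degree]
  end.

Variables (B H : nat).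
Hypotheses (H2 : 2 <= H) (HB : H ^ max_degree < B).

Definition bounded (s : memory) := forall a i, s a i <= H.

Lemma degree_gt0 x : 0 < degree x.
Proof. by elim: x => // -[] y IHy z IHz //=; rewrite addn_gt0 IHy. Qed.

(** Both powers are at least 2, so their sum is at most their product; this is why [degree] may
    treat [Add] like [Mul]. A truncated difference never exceeds its first argument. *)
Lemma den_le s x : bounded s -> tame x -> den s x <= H ^ degree x.
Proof.
move=> bs; elim: x => [k|a i _|o y IHy z IHz] /=.
- by move=> k2; rewrite expn1; apply: leq_trans H2.
- by rewrite expn1.
case/and3P=> /IHy ly /IHz lz _.
have py : 2 <= H ^ degree y.
  by apply: leq_trans H2 _; rewrite -{1}(expn1 H) leq_pexp2l ?degree_gt0 //; apply: leq_trans H2.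
have pz : 2 <= H ^ degree z.
  by apply: leq_trans H2 _; rewrite -{1}(expn1 H) leq_pexp2l ?degree_gt0 //; apply: leq_trans H2.
case: o => /=.
- by rewrite expnD; move: ly lz py pz; clear; nia.
- by apply: leq_trans ly; apply: leq_subr.
- by rewrite expnD; apply: leq_mul.
Qed.

Lemma eval_den s x : bounded s -> tame x -> eval B s x = Some (den s x).
Proof.
move=> bs; have small y : tame y -> degree y <= max_degree -> word B (den s y) = Some (den s y).
  move=> ty dy; rewrite /word ifT //; apply: leq_ltn_trans HB.
  by apply: leq_trans (den_le bs ty) _; rewrite leq_exp2l.
elim: x => [k tk|a i IH ti|o y IHy z IHz t].
- exact: (small (Const k)).
- by rewrite /= IH //; apply: (small (Cell a i)).
- have /and3P[ty tz d] := t; rewrite /= IHy // IHz //.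
  exact: (small (Bin o y z)).
Qed.

(** A total correctness triple with a time budget. Boundedness of the memory is carried along since
    every evaluation relies on it. *)
Definition runs c s T (Q : memory -> Prop) :=
  exists t s', [/\ exec B c s t s', t <= T, bounded s' & Q s'].

Lemma runs_weaken c s T T' (Q Q' : memory -> Prop) : runs c s T Q -> T <= T' ->
  (forall s', bounded s' -> Q s' -> Q' s') -> runs c s T' Q'.
Proof.
move=> [t [s' [ex lt bs Qs]]] TT QQ; exists t, s'; split=> //; last exact: QQ.
exact: leq_trans TT.
Qed.

Lemma bounded_write s a i x : bounded s -> x <= H -> bounded (write s a i x).
Proof. by move=> bs xH b j; rewrite /write; case: ifP. Qed.

Lemma runs_skip s T (Q : memory -> Prop) : bounded s -> 0 < T -> Q s -> runs Skip s T Q.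
Proof. by move=> bs T0 Qs; exists 1, s; split=> //; apply: ExecSkip. Qed.

Lemma runs_store a i x s T (Q : memory -> Prop) : bounded s -> tame i -> tame x ->
  den s x <= H -> (expr_cost i + expr_cost x).+1 <= T ->
  Q (write s a (den s i) (den s x)) -> runs (Store a i x) s T Q.
Proof.
move=> bs ti tx xH cT Qs; exists (expr_cost i + expr_cost x).+1.
exists (write s a (den s i) (den s x)); split=> //; last exact: bounded_write.
by apply: ExecStore; apply: eval_den.
Qed.

Lemma runs_seq c1 c2 s T1 T2 Q1 (Q : memory -> Prop) : runs c1 s T1 Q1 ->
  (forall s1, bounded s1 -> Q1 s1 -> runs c2 s1 T2 Q) ->
  runs (Seq c1 c2) s (T1 + T2) Q.
Proof.
move=> [t1 [s1 [ex1 l1 b1 Qs1]]] /(_ s1 b1 Qs1)[t2 [s2 [ex2 l2 b2 Qs2]]].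
by exists (t1 + t2), s2; split=> //; [apply: ExecSeq ex1 ex2 | apply: leq_add].
Qed.

Lemma runs_assign a i x c s T (Q : memory -> Prop) : bounded s -> tame i -> tame x ->
  den s x <= H ->
  (bounded (write s a (den s i) (den s x)) ->
    runs c (write s a (den s i) (den s x)) T Q) ->
  runs (Seq (Store a i x) c) s ((expr_cost i + expr_cost x).+1 + T) Q.
Proof.
move=> bs ti tx xH rc; have bw := @bounded_write s a (den s i) (den s x) bs xH.
apply: (runs_seq (Q1 := fun s1 => s1 = write s a (den s i) (den s x))).
  exact: runs_store.
by move=> s1 _ ->; apply: rc.
Qed.

Lemma runs_set k l a i x c s T (Q : memory -> Prop) : bounded s -> tame i -> tame x ->
  den s i = k -> den s x = l -> l <= H ->
  (bounded (write s a k l) -> runs c (write s a k l) T Q) ->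
  runs (Seq (Store a i x) c) s ((expr_cost i + expr_cost x).+1 + T) Q.
Proof. by move=> bs ti tx <- <-; apply: runs_assign. Qed.

Lemma runs_set1 k l a i x s T (Q : memory -> Prop) : bounded s -> tame i -> tame x ->
  den s i = k -> den s x = l -> l <= H -> (expr_cost i + expr_cost x).+1 <= T ->
  Q (write s a k l) -> runs (Store a i x) s T Q.
Proof. by move=> bs ti tx <- <-; apply: runs_store. Qed.

Lemma runs_le c s T T' Q : runs c s T Q -> T <= T' -> runs c s T' Q.
Proof. by move=> r l; apply: runs_weaken r l _. Qed.

Lemma runs_if x c1 c2 s T (Q : memory -> Prop) : bounded s -> tame x ->
  (den s x <> 0 -> runs c1 s T Q) -> (den s x = 0 -> runs c2 s T Q) ->
  runs (If x c1 c2) s (expr_cost x + T).+1 Q.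
Proof.
move=> bs tx r1 r2; have ex := eval_den bs tx; case dx: (den s x) => [|k].
  have [t [s' [E lt b Qs]]] := r2 dx; exists (expr_cost x + t).+1, s'; split=> //.
    by apply: ExecIfFalse E; rewrite ex dx.
  by rewrite ltnS leq_add2l.
have [|t [s' [E lt b Qs]]] := r1; first by rewrite dx.
exists (expr_cost x + t).+1, s'; split=> //.
  by apply: ExecIfTrue E; rewrite ex dx.
by rewrite ltnS leq_add2l.
Qed.

Definition Var a := Cell a (Const 0).

Definition For a b body :=
  Seq (Store a (Const 0) (Const 0))
    (While (Bin Defs.Sub b (Var a))
       (Seq body (Store a (Const 0) (Bin Add (Var a) (Const 1))))).

(* The bound [b] is re-evaluated before each round, so the range may grow
   while the loop runs; [m] is an a priori bound on it. *)
Lemma runs_for a b body (I : nat -> memory -> Prop) m t s (Q : memory -> Prop) :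
  bounded s -> tame (Bin Defs.Sub b (Var a)) -> expr_cost b <= 12 -> m < H ->
  I 0 (write s a 0 0) ->
  (forall k s, bounded s -> I k s -> s a 0 = k /\ den s b <= m) ->
  (forall k s, bounded s -> I k s -> k < den s b -> k < m ->
     runs body s t (fun s' => s' a 0 = k /\ I k.+1 (write s' a 0 k.+1))) ->
  (forall k s, bounded s -> I k s -> den s b <= k -> Q s) ->
  runs (For a b body) s (m.+1 * (t + 30)) Q.
Proof.
move=> bs tb cb mH I0 Ivar Ibody IQ.
rewrite /For; set test := Bin Defs.Sub b (Var a).
set wh := While _ _.
have loop j k s1 : bounded s1 -> I k s1 -> m - k <= j ->
    runs wh s1 ((m - k) * (t + 30) + 20) Q.
  elim: j k s1 => [|j IH] k s1 b1 I1 mj.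
    have [vk bm] := Ivar k s1 b1 I1.
    exists (expr_cost test).+1, s1; split=> //.
    - by apply: ExecWhileFalse; rewrite eval_den //= vk; congr Some; lia.
    - by rewrite /test /=; move: (_ * _) => z; lia.
    - by apply: (IQ k) => //; lia.
  have [vk bm] := Ivar k s1 b1 I1.
  have [kb|bk] := ltnP k (den s1 b); last first.
    exists (expr_cost test).+1, s1; split=> //; last exact: (IQ k).
    - by apply: ExecWhileFalse; rewrite eval_den //= vk; congr Some; lia.
    - by rewrite /test /=; move: (_ * _) => z; lia.
  have km : k < m by lia.
  have [t1 [s2 [E1 l1 b2 [vk2 I2]]]] := Ibody k s1 b1 I1 kb km.
  have b3 : bounded (write s2 a 0 k.+1) by apply: bounded_write => //; lia.
  have [|t2 [s3 [E2 l2 b4 Q3]]] := IH k.+1 _ b3 I2; first by lia.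
  exists (expr_cost test + (t1 + 6) + t2).+1, s3; split=> //.
    apply: (@ExecWhileTrue _ _ _ _ _ _ (den s1 b - k).-1) E2.
      by rewrite eval_den //= vk; congr Some; lia.
    apply: ExecSeq E1 _.
    have -> : 6 = (expr_cost (Const 0) + expr_cost (Bin Add (Var a) (Const 1))).+1 by [].
    apply: ExecStore; rewrite eval_den //= vk2; congr Some; lia.
  have -> : m - k = (m - k.+1).+1 by lia.
  by rewrite mulSn /test /=; lia.
have -> : m.+1 * (t + 30) = 3 + ((m - 0) * (t + 30) + (t + 27)) by rewrite subn0 mulSn; lia.
apply: runs_assign => //; move=> b0.
apply: runs_weaken (loop m 0 _ b0 I0 _) _ _ => //; lia.
Qed.

End Logic.

(** * The program *)

Section Trie.
Implicit Types (ch f g : nat -> nat).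

Fixpoint walk ch f k := if k is k'.+1 then ch (2 * walk ch f k' + f k') else 1.

(* Node 0 means "absent" and node 1 is the root; [cnt] is the next fresh node. *)
Definition trie_ok ch cnt := [/\ 2 <= cnt, forall x, ch x <> 0 -> 2 <= x /\ ch x < cnt &
  forall x y, ch x <> 0 -> ch x = ch y -> x = y].

Definition extends ch ch' := forall x, ch x <> 0 -> ch' x = ch x.

(** No pointer is stored below address 2, so the two cells of the absent node 0 are empty, and a
    walk that falls off the trie never comes back. *)
Lemma walk_pred ch cnt f k : trie_ok ch cnt -> f k <= 1 -> walk ch f k.+1 <> 0 -> walk ch f k <> 0.
Proof. by move=> [_ ok _] fk /= /ok[+ _] w0; rewrite w0; lia. Qed.

(** Child pointers are not shared, so a node determines the address [2 * p + b] that points to it,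
    hence its parent and the last bit, and so by induction the whole word. *)
Lemma walk_inj ch cnt f g k : trie_ok ch cnt -> (forall j, f j <= 1) -> (forall j, g j <= 1) ->
  walk ch f k <> 0 -> walk ch f k = walk ch g k -> forall j, j < k -> f j = g j.
Proof.
move=> ok f1 g1; elim: k => // k IH nz eq j jk.
have e2 : 2 * walk ch f k + f k = 2 * walk ch g k + g k.
  by case: ok => _ _ inj; apply: inj nz eq.
have fk := f1 k; have gk := g1 k.
have [ew efk] : walk ch f k = walk ch g k /\ f k = g k by lia.
have [->//|njk] := eqVneq j k.
apply: IH => //; last by lia.
exact: (walk_pred ok (f1 k) nz).
Qed.

Lemma walk_extends ch cnt ch' f k : trie_ok ch cnt -> (forall j, f j <= 1) -> extends ch ch' ->
  walk ch f k <> 0 -> walk ch' f k = walk ch f k.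
Proof.
move=> ok f1 ext; elim: k => // k IH nz.
by rewrite /= IH; [apply: ext | exact: (walk_pred ok (f1 k) nz)].
Qed.

Lemma trie_grow ch ch' cnt x : trie_ok ch cnt -> 2 <= x -> ch x = 0 ->
  (forall y, ch' y = if y == x then cnt else ch y) -> trie_ok ch' cnt.+1 /\ extends ch ch'.
Proof.
move=> [c2 ok inj] x2 cx E; split; last first.
  by move=> y nz; rewrite E; case: eqP => // eyx; rewrite eyx in nz.
split; first by lia.
- by move=> y; rewrite E; case: eqP => [->|_ /ok[]]; lia.
- move=> y z; rewrite !E; do 2 case: eqP => [->|_] //.
  + by move=> _ ez; have := ok z; lia.
  + by move=> nz; have := ok y nz; lia.
  + exact: inj.
Qed.

End Trie.

Notation "x [+] y" := (Bin Add x y) (at level 50, left associativity).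
Notation "x [-] y" := (Bin Defs.Sub x y) (at level 50, left associativity).
Notation "x [*] y" := (Bin Mul x y) (at level 40, left associativity).
Notation "c ;; d" := (Seq c d) (at level 70, right associativity).
Notation "a ::= x" := (Store a (Const 0) x) (at level 65).

(* Set number [l] has its characteristic vector in row [l] of [rows], and in row
   [l] of [nbrs] the number of its members adjacent to each vertex.  The children
   of trie node [p] are [child (2 * p)] and [child (2 * p + 1)]; [index p] is the
   number plus one of the set whose characteristic vector leads to [p], and 0 if
   there is none.  Triple [q] says that set [union q] is the disjoint union of the
   adjacent sets [left q] and [right q]. *)
Notation answers := 3.
Notation answer := 4.
Notation nsets := 5.
Notation rows := 6.
Notation nbrs := 7.
Notation child := 8.
Notation fresh := 9.
Notation index := 10.
Notation node := 11.
Notation left := 12.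
Notation right := 13.
Notation union := 14.
Notation ntriples := 15.
Notation value := 16.
Notation vi := 17.
Notation vj := 18.
Notation vu := 19.
Notation meet := 20.
Notation touch := 21.
Notation vr := 22.
Notation vq := 23.
Notation vd := 24.
Notation vc := 25.

Definition nV := Cell 0 (Const 0).
Definition nC := Cell 0 (Const 1).

Definition slot a := Cell a (Var nsets [*] nV [+] Var vu).
Definition branch := Const 2 [*] Var node [+] slot rows.

(* The new set is first written to the spare row [nsets]; the row becomes
   permanent only if the set turns out not to be listed yet. *)
Definition Insert sx nx :=
  node ::= Const 1 ;;
  For vu nV (
    Store rows (Var nsets [*] nV [+] Var vu) sx ;;
    Store nbrs (Var nsets [*] nV [+] Var vu) nx ;;
    If (Cell child branch) Skip
      (Store child branch (Var fresh) ;; fresh ::= Var fresh [+] Const 1) ;;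
    node ::= Cell child branch) ;;
  If (Cell index (Var node)) Skip
    (nsets ::= Var nsets [+] Const 1 ;; Store index (Var node) (Var nsets)).

Definition frame (X : seq nat) (s s' : memory) := forall a i, a \notin X -> s' a i = s a i.

Lemma frame_refl X s : frame X s s. Proof. by []. Qed.

Lemma frame_write X s s' a i x : a \in X -> frame X s s' -> frame X s (write s' a i x).
Proof.
move=> aX fr b j bX; rewrite /write; case: eqP => [eba|_] /=; last exact: fr.
by rewrite eba aX in bX.
Qed.

Lemma frame_trans X s1 s2 s3 : frame X s1 s2 -> frame X s2 s3 -> frame X s1 s3.
Proof. by move=> f g a i aX; rewrite g // f. Qed.

Lemma frame_sub (X Y : seq nat) s s' : {subset X <= Y} -> frame X s s' -> frame Y s s'.
Proof. by move=> XY f a i aY; apply: f; apply: contra aY => /XY. Qed.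

Lemma cell_lt l k m n : l < m -> k < n -> l * n + k < m * n.
Proof.
move=> lm kn; apply: leq_trans (_ : l.+1 * n <= _); last by rewrite leq_mul2r lm orbT.
by rewrite mulSn; lia.
Qed.

(** * Correctness *)

Section Verification.
Variables (V C : finType) (e : rel V) (w : {ffun V -> C}) (v0 : V) (B H n c : nat).
Hypotheses (card_V : #|V| = n) (card_C : #|C| = c).
Hypothesis e_sym : symmetric e.
Hypotheses (H2 : 2 <= H) (HB : H ^ max_degree < B).
Notation runs := (runs B H).
Notation bounded := (bounded H).

Implicit Types (A : {set V}) (As : seq {set V}) (s : memory).

Definition vtx k := nth v0 (enum V) k.
Definition clr k := nth (w v0) (enum C) k.
Definition bit (A : {set V}) k : nat := vtx k \in A.
Definition degin (A : {set V}) k := \sum_(x in A) (e x (vtx k) : nat).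

Definition input_ok (s : memory) := [/\ s 0 0 = n, s 0 1 = c,
  forall a b, a < n -> b < n -> s 1 (a * n + b) = e (vtx a) (vtx b) &
  forall a, a < n -> s 2 a < c /\ clr (s 2 a) = w (vtx a)].

Lemma bit1 A k : bit A k <= 1. Proof. by rewrite /bit; case: (_ \in _). Qed.

Lemma vtx_surj v : exists2 k, k < n & vtx k = v.
Proof. by exists (enum_rank v); rewrite -?card_V ?ltn_ord // /vtx nth_enum_rank. Qed.

Lemma bit_inj A A' : (forall k, k < n -> bit A k = bit A' k) -> A = A'.
Proof.
move=> eq; apply/setP => v; have [k kn <-] := vtx_surj v.
by move: (eq k kn); rewrite /bit; do 2 case: (_ \in _).
Qed.

Definition index_ok (s : memory) (As : seq {set V}) :=
  (forall l, l < size As -> let p := walk (s child) (bit (nth set0 As l)) n in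
     p <> 0 /\ s index p = l.+1) /\
  (forall p, s index p <> 0 -> exists l, [/\ l < size As, s index p = l.+1 &
     p = walk (s child) (bit (nth set0 As l)) n]).

Definition rows_ok (s : memory) (As : seq {set V}) :=
  forall l k, l < size As -> k < n ->
    s rows (l * n + k) = bit (nth set0 As l) k /\
    s nbrs (l * n + k) = degin (nth set0 As l) k.

Definition sets_ok (As : seq {set V}) := uniq As /\ {in As, forall A, cset e A}.

Definition family (s : memory) As := [/\ s nsets 0 = size As, rows_ok s As,
  trie_ok (s child) (s fresh 0), index_ok s As & sets_ok As].

Definition insert_vars := [:: nsets; rows; nbrs; child; fresh; index; node; vu].

Definition add_set (As : seq {set V}) A := if A \in As then As else rcons As A.

Lemma sets_size As : sets_ok As -> size As <= num_connected_subgraphs e.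
Proof.
move=> [uA cA]; apply: leq_trans (card_csets e); rewrite -(card_uniqP uA).
by apply: subset_leq_card; apply/subsetP => A /cA; rewrite inE.
Qed.

(** The neighbour counts must be right only for a set that is not yet listed, since otherwise the
    spare row is discarded. This allows the same code to serve as a mere lookup. *)
Lemma runs_insert s As A sx nx : bounded s -> input_ok s -> family s As -> cset e A ->
  tame sx -> tame nx -> expr_cost sx <= 20 -> expr_cost nx <= 20 ->
  (forall s' k, k < n -> s' vu 0 = k -> frame [:: rows; nbrs; child; fresh; node; vu] s s' ->
     (forall j, j < size As * n -> s' rows j = s rows j /\ s' nbrs j = s nbrs j) ->
     [/\ den s' sx = bit A k, den s' nx <= H & A \notin As -> den s' nx = degin A k]) ->
  s fresh 0 + n < H -> n < H -> num_connected_subgraphs e < H ->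
  runs (Insert sx nx) s (300 * n.+1) (fun s' => [/\ family s' (add_set As A),
    frame insert_vars s s', s' fresh 0 <= s fresh 0 + n &
    exists l, [/\ l < size (add_set As A), nth set0 (add_set As A) l = A &
      s' index (s' node 0) = l.+1]]).
Proof.
move=> bs [i0 i1 i2 i3] [fM fR fT fI fS] cA tsx tnx csx cnx hsx fH nH NH.
have szN := sets_size fS; have ok1 := bit1 A.
pose I k (s' : memory) := [/\ s' vu 0 = k, k <= n,
  frame [:: rows; nbrs; child; fresh; node; vu] s s' /\
  forall j, j < size As * n -> s' rows j = s rows j /\ s' nbrs j = s nbrs j,
  forall j, j < k -> s' rows (size As * n + j) = bit A j /\
     (A \notin As -> s' nbrs (size As * n + j) = degin A j) &
  [/\ trie_ok (s' child) (s' fresh 0), extends (s child) (s' child),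
    s' node 0 = walk (s' child) (bit A) k, s' node 0 <> 0 & s' fresh 0 <= s fresh 0 + k]].
have step k s1 : bounded s1 -> I k s1 -> k < den s1 nV -> k < n ->
  runs (Store rows (Var nsets [*] nV [+] Var vu) sx ;;
    Store nbrs (Var nsets [*] nV [+] Var vu) nx ;;
    If (Cell child branch) Skip
      (Store child branch (Var fresh) ;; fresh ::= Var fresh [+] Const 1) ;;
    node ::= Cell child branch) s1 170 
   (fun s' => s' vu 0 = k /\ I k.+1 (write s' vu 0 k.+1)).
  move=> b1 [vk kn [fr keep] new [t1 ext p1 p0 c1]] _ kltn.
  have Mn : s1 nsets 0 = size As by rewrite fr.
  have N1 : s1 0 0 = n by rewrite fr.
  have [dsx dnx dnx'] := hsx s1 k kltn vk fr keep.
  set a := size As * n + k; set p := s1 node 0 in p1 p0; set b := bit A k.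
  have da s' : s' nsets 0 = size As -> s' 0 0 = n -> s' vu 0 = k ->
    den s' (Var nsets [*] nV [+] Var vu) = a by move=> /= -> -> ->.
  have b1' : b <= 1 := ok1 k.
  apply: runs_le.
    apply: (@runs_set _ _ H2 HB a b) => //; [exact: da | by lia |]; move=> b2.
    have [||_ ex ex'] := hsx (write s1 rows a b) k kltn vk _ _.
    - exact: frame_write.
    - by move=> j jM; split; rewrite -?(keep _ jM).1 -?(keep _ jM).2 // /write /= ifN //; apply/eqP; rewrite /a; lia.
    apply: (@runs_set _ _ H2 HB a (den (write s1 rows a b) nx)) => //; first exact: da.
    move: (den _ nx) ex ex' => g gH gA b3; set s3 := write _ nbrs a g.
    have db s' : frame [:: child; fresh] s3 s' -> den s' branch = 2 * p + b.
      move=> fr'; rewrite /= !fr' // /s3 /write /= Mn N1 vk eqxx //.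
    apply: (runs_seq (T1 := 60) (T2 := 40) (Q1 := fun s' => [/\ frame [:: child; fresh] s3 s', trie_ok (s' child) (s' fresh 0),
        extends (s1 child) (s' child), s' child (2 * p + b) <> 0 & s' fresh 0 <= (s1 fresh 0).+1])).
      apply: runs_le; first apply: (runs_if H2 HB (T := 30)) => //.
      + move=> nz; apply: runs_skip => //; split=> //.
        by rewrite -(db s3 (@frame_refl _ s3)).
      + move=> z; have z' : s1 child (2 * p + b) = 0 by rewrite -[LHS]/(s3 child (2 * p + b)) -(db s3 (@frame_refl _ s3)).
        apply: runs_le; first apply: (@runs_set _ _ H2 HB (2 * p + b) (s1 fresh 0)) => //.
        * exact: db.
        * move=> b4; apply: (@runs_set1 _ _ H2 HB 0 (s1 fresh 0).+1 _ _ _ _ 10) => //.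
          - by rewrite /= addn1.
          - by lia.
          have [||t' ext'] := @trie_grow _ (write s3 child (2 * p + b) (s1 fresh 0) child) _ (2 * p + b) t1 _ z' _.
          - by lia.
          - by move=> y; rewrite /write /=; case: eqP.
          split=> //.
          - by do 2 (apply: frame_write => //).
          - by rewrite /write /= eqxx; case: t1; lia.
        * by [].
      + by [].
    move=> s4 b4 [fr4 t4 ext4 nz4 cnt4].
    apply: (@runs_set1 _ _ H2 HB 0 (s4 child (2 * p + b))) => //.
      by rewrite /= -(db s4 fr4).
    have f4 : frame [:: rows; nbrs; child; fresh; node; vu] s (write (write s4 node 0 (s4 child (2 * p + b))) vu 0 k.+1).
      do 2 (apply: frame_write => //).
      have: frame [:: rows; nbrs; child; fresh; node; vu] s3 s4.
        by apply: frame_sub fr4 => x; rewrite !inE => /orP[] ->; rewrite ?orbT.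
      by apply: frame_trans; do 2 (apply: frame_write => //).
    have row4 j : s4 rows j = if j == a then b else s1 rows j by rewrite fr4.
    have nbr4 j : s4 nbrs j = if j == a then g else s1 nbrs j by rewrite fr4.
    split; first by rewrite /= /write /= fr4.
    split=> //.
    - split=> // j jM; have ja : j == a = false by apply/eqP; rewrite /a; lia.
      by rewrite /write /= row4 nbr4 ja; apply: keep.
    - move=> j jk; rewrite /write /= row4 nbr4.
      have [ejk|njk] := eqVneq j k; first by rewrite ejk eqxx.
      have -> : (size As * n + j == a) = false by apply/eqP; rewrite /a; lia.
      by apply: new; lia.
    - split=> //; rewrite /write /=.
      + by move=> x nx'; rewrite ext4 ?ext.
      + rewrite (walk_extends t1 ok1 ext4) -?p1 //; congruence.
      + by lia.
  by rewrite /=; lia.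
have nV' k s' : I k s' -> s' 0 0 = n by case=> _ _ [fr _] _ _; rewrite fr.
apply: runs_le.
  apply: (@runs_set _ _ H2 HB 0 1) => //; first by lia.
  move=> b2; apply: (runs_seq (Q1 := fun s' => I n s')).
    apply: (runs_for (I := I) (m := n) (t := 170) H2 HB) => //.
    - split=> //.
      + by split=> //; do 2 (apply: frame_write => //).
      + by rewrite /write /= addn0; split.
    - by move=> k s' _ Is; have := nV' k s' Is; case: Is => /= ? _ _ _ _ ->.
    - move=> k s' _ Is; have E := nV' k s' Is; case: (Is) => _ kn _ _ _; rewrite /= E => nk.
      by have -> : n = k by lia.
  move=> s3 b3 I3; have [_ _ [fr keep] new [t3 ext3 p3 p0 c3]] := I3.
  have Mn : s3 nsets 0 = size As by rewrite fr.
  have idx3 p : s3 index p = s index p by rewrite fr.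
  have walk3 l : l < size As -> walk (s3 child) (bit (nth set0 As l)) n =
      walk (s child) (bit (nth set0 As l)) n.
    by move=> lM; apply: (walk_extends fT (bit1 _) ext3); case: (fI.1 l lM).
  have rows3 : rows_ok s3 As.
    move=> l k lM kn; have lk : l * n + k < size As * n by apply: cell_lt.
    by have [-> ->] := keep _ lk; apply: fR.
  have fr' : frame insert_vars s s3.
    by apply: frame_sub fr => x; rewrite !inE; do !case: eqP.
  apply: runs_le; first apply: (runs_if H2 HB (T := 40)) => //.
  - rewrite /= idx3 p3 => nz; apply: runs_skip => //.
    (* A nonzero index sits only at nodes reached by listed sets, and injectivity of walks
       identifies that set with [A]. *)
    have [l [lM el pl]] := fI.2 _ nz.
    have eA : nth set0 As l = A.
      apply: bit_inj => k kn; apply: (walk_inj t3 (bit1 _) (bit1 _)) kn.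
        by rewrite walk3 //; case: (fI.1 l lM).
      by rewrite walk3.
    have AAs : A \in As by rewrite -eA mem_nth.
    rewrite /add_set AAs; split=> //; last by exists l; split; rewrite // p3 idx3.
    split=> //; split.
      by move=> l' l'M /=; rewrite walk3 // idx3; apply: fI.1.
    move=> q; rewrite idx3 => /fI.2[l' [l'M el' eq]].
    by exists l'; split; rewrite ?walk3.
  - rewrite /= idx3 p3 => z.
    have AAs : A \notin As.
      apply/negP => AAs; have iM : seq.index A As < size As by rewrite index_mem.
      have W := walk3 _ iM; have [_] := fI.1 _ iM.
      by rewrite /= nth_index // in W *; rewrite -W z.
    have sz' : (size As).+1 <= num_connected_subgraphs e.
      have -> : (size As).+1 = size (A :: As) by [].
      apply: sets_size; split; first by rewrite /= AAs; case: fS.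
      by move=> D; rewrite inE => /orP[/eqP -> //|]; apply: fS.2.
    apply: runs_le.
      apply: (@runs_set _ _ H2 HB 0 (size As).+1) => //; first by rewrite /= Mn addn1.
        by lia.
      move=> b4; apply: (@runs_set1 _ _ H2 HB (walk (s3 child) (bit A) n) (size As).+1 _ _ _ _ 20) => //; first by lia.
      rewrite /add_set (negbTE AAs).
      have nA : nth set0 (rcons As A) (size As) = A by rewrite nth_rcons ltnn eqxx.
      have nl l : l < size As -> nth set0 (rcons As A) l = nth set0 As l.
        by move=> lM; rewrite nth_rcons lM.
      split=> //.
      + split; rewrite ?size_rcons //.
        * move=> l k; rewrite size_rcons ltnS leq_eqVlt => /orP[/eqP ->|lM] kn.
            by rewrite nA /write /=; have [-> /(_ AAs) ->] := new k kn.
          by rewrite nl // /write /=; apply: rows3.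
        * split.
            move=> l; rewrite size_rcons ltnS leq_eqVlt => /orP[/eqP ->|lM] /=.
              by rewrite nA -p3; split=> //; rewrite /write /= p3 eqxx.
            rewrite nl // /write /= walk3 // idx3; have [nz el] := fI.1 l lM; split=> //.
            case: eqP => // ew; case/negP: AAs.
            have -> : A = nth set0 As l.
              apply: bit_inj => k kn; apply: (walk_inj t3 (bit1 _) (bit1 _)) kn.
                by rewrite -ew.
              by rewrite walk3.
            by rewrite mem_nth.
          move=> q; rewrite /write /=; case: eqP => [-> _|nq].
            by exists (size As); rewrite size_rcons nA.
          rewrite idx3 => /fI.2[l [lM el eq]]; exists l.
          by rewrite size_rcons nl // walk3 //; split=> //; apply: leqW.
        * split; first by rewrite rcons_uniq AAs; case: fS.
          by move=> D; rewrite mem_rcons inE => /orP[/eqP -> //|]; apply: fS.2.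
      + by do 2 (apply: frame_write => //).
      + by exists (size As); rewrite size_rcons nA /write /= p3 eqxx.
    by [].
  - by [].
by rewrite /=; lia.
Qed.

Lemma family_frame X s s' As : frame X s s' ->
  all (fun a => a \notin X) [:: nsets; rows; nbrs; child; fresh; index] ->
  family s As -> family s' As.
Proof.
move=> fr /and5P[aM aR aN aC /and3P[aF aI _]] [fM fR fT fI fS].
have ch x : s' child x = s child x by rewrite fr.
have W f k : walk (s' child) f k = walk (s child) f k.
  by elim: k => //= k ->; rewrite ch.
split=> //.
- by rewrite fr.
- by move=> l k lM kn; rewrite !fr //; apply: fR.
- case: fT => f2 fl fj; rewrite fr //; split=> // [x|x y]; rewrite !ch; [exact: fl|exact: fj].
- split=> [l lM|p].
    by rewrite /= W fr //; apply: fI.1.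
  by rewrite fr // => /fI.2[l [lM el eq]]; exists l; rewrite W.
Qed.

Lemma family_write s As a i x :
  a \notin [:: nsets; rows; nbrs; child; fresh; index] ->
  family s As -> family (write s a i x) As.
Proof.
move=> na; apply: (@family_frame [:: a]); first by apply: frame_write; rewrite ?inE.
by move: na; rewrite /= !inE !negb_or !(eq_sym a) andbT.
Qed.

Lemma input_frame X s s' : frame X s s' -> all (fun a => a \notin X) [:: 0; 1; 2] ->
  input_ok s -> input_ok s'.
Proof.
move=> fr /and4P[a0 a1 a2 _] [i0 i1 i2 i3]; split; rewrite ?fr //.
  by move=> a b an bn; rewrite fr //; apply: i2.
by move=> a an; rewrite fr //; apply: i3.
Qed.

Lemma degin1 v k : degin [set v] k = e v (vtx k).
Proof. by rewrite /degin big_set1. Qed.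

Lemma degin_le A k : degin A k <= n.
Proof.
apply: leq_trans (_ : \sum_(x in A) 1 <= n); last by rewrite sum1_card -card_V max_card.
by apply: leq_sum => x _; case: (e _ _).
Qed.

(** The reason for storing counts: both rows of a disjoint union are plain sums of the rows of its
    parts. *)
Lemma deginU A (A' : {set V}) k : [disjoint A & A'] -> degin (A :|: A') k = degin A k + degin A' k.
Proof.
move=> d; rewrite /degin (eq_bigl [predU A & A']); last by move=> x; rewrite !inE.
by rewrite bigU.
Qed.

Lemma bitU A (A' : {set V}) k : [disjoint A & A'] -> bit (A :|: A') k = bit A k + bit A' k.
Proof.
move/disjoint_setI0/setP/(_ (vtx k)); rewrite /bit !inE.
by do 2 case: (_ \in _).
Qed.

Lemma degin_neq0 A k : degin A k <> 0 <-> exists2 x, x \in A & e x (vtx k).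
Proof.
split=> [/eqP|[x xA exk]].
  rewrite /degin sum_nat_eq0 negb_forall => /existsP[x].
  by rewrite negb_imply => /andP[xA ex]; exists x => //; case: (e _ _) ex.
by rewrite /degin (bigD1 x) //= exk; lia.
Qed.

(** * Bounds on the stored numbers *)

Section Bounds.
Variables (N : nat).
Hypothesis num_le : num_connected_subgraphs e <= N.
Hypothesis H_large : 20 * c * N ^ 3 < H.

Lemma n_le_N : n <= N.
Proof.
apply: leq_trans num_le; apply: leq_trans (card_csets e).
rewrite -card_V -cardsT -(card_imset _ (@set1_inj V)); apply: subset_leq_card.
by apply/subsetP => A /imsetP[x _ ->]; rewrite inE cset1.
Qed.

Lemma n_gt0 : 0 < n. Proof. by rewrite -card_V; apply/card_gt0P; exists v0. Qed.
Lemma c_gt0 : 0 < c. Proof. by rewrite -card_C; apply/card_gt0P; exists (w v0). Qed.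

(** The cubic term comes from the trie: [n] singletons and at most [N * N] joins create at most [n]
    nodes each, and [n <= N]. The factor [c] in [H_large] accommodates the colour numbers. *)
Lemma H_bounds : [/\ n < H, 3 * N * N + 3 * N < H, c < H, n * n < H &
  forall k, k <= N * N -> 2 + n * (n + k) + 2 * n < H].
Proof.
have h1 := n_le_N; have h2 := n_gt0; have h3 := c_gt0.
have N0 : 0 < N by lia.
have hN : 20 * (N * N * N) < H.
  apply: leq_trans H_large; rewrite ltnS !expnS expn0 muln1; nia.
have hc : c < H.
  apply: leq_trans H_large; rewrite ltnS.
  have : 1 <= N ^ 3 by rewrite expn_gt0 N0.
  nia.
have N2 : N * N <= N * N * N by rewrite leq_pmulr.
have N1 : N <= N * N by rewrite leq_pmulr.
have nn : n * n <= N * N by apply: leq_mul.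
split=> //; try by lia.
move=> k kN; have : n * (n + k) <= N * (N + N * N) by apply: leq_mul => //; lia.
by nia.
Qed.

Lemma vtx_inj i j : i < n -> j < n -> vtx i = vtx j -> i = j.
Proof.
move=> ni nj /eqP; rewrite /vtx nth_uniq ?enum_uniq -?cardE ?card_V //; exact: eqP.
Qed.

(** * Enumeration of the connected sets *)

Definition Singletons := For vi nV
  (Insert (Const 1 [-] ((Var vu [-] Var vi) [+] (Var vi [-] Var vu)))
          (Cell 1 (Var vi [*] nV [+] Var vu))).

Definition singles k : seq {set V} := [seq [set vtx j] | j <- iota 0 k].

Lemma nth_singles k j : j < k -> nth set0 (singles k) j = [set vtx j].
Proof.
by move=> jk; rewrite (nth_map 0) ?size_iota // nth_iota.
Qed.

Lemma runs_singletons s : bounded s -> input_ok s -> family s [::] -> s fresh 0 = 2 ->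
  runs Singletons s (n.+1 * (300 * n.+1 + 30)) (fun s' => [/\ family s' (singles n),
    frame (vi :: insert_vars) s s' & s' fresh 0 <= 2 + n * n]).
Proof.
have [nH NH cH nnH frH] := H_bounds.
move=> bs inp fam f2.
pose I k (s' : memory) := [/\ s' vi 0 = k, k <= n, family s' (singles k),
    frame (vi :: insert_vars) s s' & s' fresh 0 <= 2 + n * k].
apply: (runs_for (I := I) (m := n) H2 HB) => //.
- split=> //; last by rewrite /write /= f2.
  exact: frame_write.
- move=> k s' _ [vk _ _ fr _]; split=> //.
  by rewrite /= fr //; case: inp => ->.
- move=> k s' b' [vk kn fam' fr' fc] _ kltn.
  have inp' := input_frame fr' isT inp; have [i0 _ i2 _] := inp'.
  apply: runs_weaken (@runs_insert s' _ [set vtx k] _ _ b' inp' fam' _ _ _ _ _ _ _ nH _) _ _ => //.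
  + exact: cset1.
  + move=> s1 u un vu1 fr1 keep; split.
    (* In truncated subtraction [1 - ((u - k) + (k - u))] is 1 if [u = k] and 0 otherwise. *)
    * rewrite /= vu1 fr1 // vk /bit inE.
      have [->|nuk] := eqVneq u k; first by rewrite eqxx subnn.
      case: eqP => [/(vtx_inj un kltn)|_]; first by move/eqP: nuk.
      by move/eqP: nuk; lia.
    * by rewrite /= vu1 !fr1 //.
    * by move=> _; rewrite /= vu1 !fr1 // vk i0 i2 // degin1.
  + have := frH 0; rewrite addn0; nia.
  + have := num_le; nia.
  + move=> s1 b1 [fam1 fr1 fc1 _]; split; first by rewrite fr1.
    have E : add_set (singles k) [set vtx k] = singles k.+1.
      rewrite /add_set ifN; last first.
        apply/negP => /mapP[j]; rewrite mem_iota add0n => jk /set1_inj /(vtx_inj kltn).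
        by lia.
      by rewrite /singles -addn1 iotaD map_cat cats1.
    split=> //.
    * rewrite E in fam1.
      exact: family_write.
    * apply: frame_write => //; apply: frame_trans fr' _.
      by apply: frame_sub fr1 => x xX; rewrite inE xX orbT.
    * by apply: (leq_trans fc1); rewrite mulnS; lia.
- move=> k s' _ [vk kn fam' fr' fc]; rewrite /= fr' //; case: inp => -> _ _ _ nk.
  have ek : k = n by lia.
  by rewrite ek in fam' fc; split.
Qed.

(** With the neighbour counts at hand a single pass suffices: [touch] becomes the number of edges
    between the two sets and [meet] the size of their intersection. *)
Definition Compare :=
  meet ::= Const 0 ;; touch ::= Const 0 ;;
  For vu nV (
    touch ::= Var touch [+] Cell nbrs (Var vi [*] nV [+] Var vu) [*] Cell rows (Var vj [*] nV [+] Var vu) ;;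
    meet ::= Var meet [+] Cell rows (Var vi [*] nV [+] Var vu) [*] Cell rows (Var vj [*] nV [+] Var vu)).

Lemma runs_compare s As i j : bounded s -> input_ok s -> family s As ->
  s vi 0 = i -> s vj 0 = j -> i < size As -> j < size As ->
  runs Compare s (200 * n.+1) (fun s' => [/\ frame [:: meet; touch; vu] s s',
    s' touch 0 <> 0 <-> adj e (nth set0 As i) (nth set0 As j) &
    s' meet 0 = 0 <-> [disjoint nth set0 As i & nth set0 As j]]).
Proof.
have [nH NH cH nnH frH] := H_bounds.
move=> bs inp [_ fR _ _ _] vi_s vj_s iM jM; set X := nth set0 As i; set Y := nth set0 As j.
have [i0 _ _ _] := inp.
pose I k (s' : memory) := [/\ s' vu 0 = k, k <= n, frame [:: meet; touch; vu] s s',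
  s' touch 0 <= k * n /\ (s' touch 0 <> 0 <-> exists u, u < k /\ degin X u * bit Y u <> 0) &
  s' meet 0 <= k /\ (s' meet 0 <> 0 <-> exists u, u < k /\ bit X u * bit Y u <> 0)].
apply: runs_le.
  apply: (@runs_set _ _ H2 HB 0 0) => // b1.
  apply: (@runs_set _ _ H2 HB 0 0) => // b2.
  apply: (runs_for (I := I) (m := n) (t := 100) H2 HB) => //.
  - split=> //.
    + by do 3 (apply: frame_write => //).
    + by rewrite /write /=; split=> //; split=> // -[u []].
    + by rewrite /write /=; split=> //; split=> // -[u []].
  - by move=> k s' _ [vk _ fr _ _]; split=> //; rewrite /= fr // i0.
  - move=> k s' b' [vk kn fr [tl tP] [ml mP]] _ kltn.
    have [rX nX] := fR i k iM kltn; have [rY nY] := fR j k jM kltn.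
    have dX := degin_le X k; have bX := bit1 X k; have bY := bit1 Y k.
    have e0 : s' 0 0 = n by rewrite fr.
    have e1 : s' vi 0 = i by rewrite fr.
    have e2 : s' vj 0 = j by rewrite fr.
    have e3 := fr rows (i * n + k) isT; have e4 := fr rows (j * n + k) isT.
    have e5 := fr nbrs (i * n + k) isT.
    apply: runs_le.
      apply: (@runs_set _ _ H2 HB 0 (s' touch 0 + degin X k * bit Y k)) => //.
        by rewrite /= e0 e1 e2 vk e4 e5 nX rY.
        by nia.
      move=> b3.
      apply: (@runs_set1 _ _ H2 HB 0 (s' meet 0 + bit X k * bit Y k) _ _ _ _ 50) => //.
        by rewrite /= /write /= e0 e1 e2 vk e3 e4 rX rY.
        by nia.
      split; first by rewrite /write /= vk.
      split=> //.
      + by do 3 (apply: frame_write => //).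
      + rewrite /write /=; split; first by nia.
        split=> [nz|[u [uk nz]]].
          case ez: (degin X k * bit Y k) => [|m]; last by exists k; rewrite ez.
          have [|u [uk nz']] := tP.1; first by rewrite ez addn0 in nz.
          by exists u; split=> //; lia.
        have [euk|nuk] := eqVneq u k; first by rewrite euk in nz; lia.
        by have : s' touch 0 <> 0; [apply: tP.2; exists u; split=> //; lia | lia].
      + rewrite /write /=; split; first by nia.
        split=> [nz|[u [uk nz]]].
          case ez: (bit X k * bit Y k) => [|m]; last by exists k; rewrite ez.
          have [|u [uk nz']] := mP.1; first by rewrite ez addn0 in nz.
          by exists u; split=> //; lia.
        have [euk|nuk] := eqVneq u k; first by rewrite euk in nz; lia.
        by have : s' meet 0 <> 0; [apply: mP.2; exists u; split=> //; lia | lia].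
    by [].
  - move=> k s' _ [vk kn fr [_ tP] [_ mP]]; rewrite /= fr // i0 => nk.
    have ek : k = n by lia.
    split=> //.
    + split=> [/tP[u [uk nz]]|[x [y [xX yY exy]]]].
        have [x xX exu] : exists2 x, x \in X & e x (vtx u) by apply/degin_neq0; lia.
        by exists x, (vtx u); split=> //; move: nz; rewrite /bit; case: (_ \in _) => //; lia.
      apply/tP; have [u un eu] := vtx_surj y; exists u; rewrite ek; split=> //.
      have : degin X u <> 0 by apply/degin_neq0; exists x; rewrite ?eu.
      by rewrite /bit eu yY muln1.
    + split=> [m0|dXY].
        rewrite -setI_eq0; apply/eqP/setP => y; rewrite !inE; apply/negP => /andP[yX yY].
        have [u un eu] := vtx_surj y; have : s' meet 0 <> 0; last by lia.
        by apply/mP; exists u; rewrite ek /bit eu yX yY.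
      case E: (s' meet 0) => [//|m]; have /mP[u [uk]] : s' meet 0 <> 0 by rewrite E.
      move/setP/(_ (vtx u)): (disjoint_setI0 dXY); rewrite !inE /bit.
      by do 2 case: (_ \in _).
by rewrite /=; lia.
Qed.

Definition Record_triple :=
  Store left (Var ntriples) (Var vi) ;;
  Store right (Var ntriples) (Var vj) ;;
  Store union (Var ntriples) (Cell index (Var node) [-] Const 1) ;;
  ntriples ::= Var ntriples [+] Const 1.

(** The product in the test is nonzero exactly if [touch] is nonzero and [meet] is zero. *)
Definition Pair :=
  Compare ;;
  If (Var touch [*] (Const 1 [-] Var meet))
    (Insert (Cell rows (Var vi [*] nV [+] Var vu) [+] Cell rows (Var vj [*] nV [+] Var vu))
            (Cell nbrs (Var vi [*] nV [+] Var vu) [+] Cell nbrs (Var vj [*] nV [+] Var vu)) ;;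
     Record_triple)
    Skip.

(** The list grows while the outer loop runs. An unordered pair is treated when the larger of its
    numbers is reached, at which time both sets are listed; so the loop ends only once the list is
    closed under joins. *)
Definition Pairs := For vi (Var nsets) (For vj (Var vi [+] Const 1) Pair).

Definition good s As q :=
  let i := s left q in let j := s right q in let l := s union q in
  [/\ i < size As, j < size As, l < size As,
    [disjoint nth set0 As i & nth set0 As j] /\ adj e (nth set0 As i) (nth set0 As j) &
    nth set0 As l = nth set0 As i :|: nth set0 As j].

(** Every triple comes from one insertion, so [ntriples] also counts the insertions after the [n]
    singletons and thereby bounds the number of trie nodes. *)
Definition state s As := [/\ input_ok s, family s As,
  forall k, k < n -> k < size As /\ nth set0 As k = [set vtx k],
  forall q, q < s ntriples 0 -> good s As q &
  s fresh 0 <= 2 + n * (n + s ntriples 0)].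

Definition recorded s As i j :=
  [disjoint nth set0 As i & nth set0 As j] -> adj e (nth set0 As i) (nth set0 As j) ->
  exists q, [/\ q < s ntriples 0, s left q = i & s right q = j].

Definition grows s As s' As' := [/\ forall l, l < size As -> l < size As' /\ nth set0 As' l = nth set0 As l,
  s ntriples 0 <= s' ntriples 0 &
  forall q, q < s ntriples 0 -> s' left q = s left q /\ s' right q = s right q].

Lemma grows_refl s As s' : (forall q, s' left q = s left q) -> (forall q, s' right q = s right q) ->
  s' ntriples 0 = s ntriples 0 -> grows s As s' As.
Proof. by move=> el er en; split=> //; rewrite en. Qed.

Lemma recorded_grows s As s' As' i j : grows s As s' As' -> i < size As -> j < size As ->
  recorded s As i j -> recorded s' As' i j.
Proof.
move=> [ext le eq] iM jM rec; rewrite /recorded (ext i iM).2 (ext j jM).2 => d a.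
have [q [qn ei ej]] := rec d a; exists q; have [-> ->] := eq q qn.
by split=> //; apply: leq_trans le.
Qed.

Lemma grows_trans s1 As1 s2 As2 s3 As3 : grows s1 As1 s2 As2 -> grows s2 As2 s3 As3 ->
  grows s1 As1 s3 As3.
Proof.
move=> [e1 l1 q1] [e2 l2 q2]; split.
- by move=> l lM; have [l'M <-] := e1 l lM; apply: e2.
- exact: leq_trans l2.
- by move=> q qn; have [<- <-] := q1 q qn; apply: q2; apply: leq_trans l1.
Qed.

Definition state_vars := [:: 0; 1; 2; nsets; rows; nbrs; child; fresh; index;
  left; right; union; ntriples].

Lemma state_frame X s s' As : frame X s s' -> all (fun a => a \notin X) state_vars ->
  state s As -> state s' As.
Proof.
move=> fr /allP aX [inp fam sing gd fc].
have E a : a \in state_vars -> forall i, s' a i = s a i.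
  by move=> /aX aX1 i; apply: fr.
have sub l : all (mem state_vars) l -> all (fun a => a \notin X) l.
  by move/allP=> sl; apply/allP => a /sl /aX.
split=> //.
- by apply: input_frame fr _ inp; apply: sub.
- by apply: family_frame fr _ fam; apply: sub.
- by move=> q; rewrite /good !E //; apply: gd.
- by rewrite !E.
Qed.

Lemma runs_pair s As i j : bounded s -> state s As -> s vi 0 = i -> s vj 0 = j ->
  i < size As -> j < size As -> s ntriples 0 < N * N ->
  runs Pair s (700 * n.+1) (fun s' => exists As', [/\ state s' As',
    s' vi 0 = i /\ s' vj 0 = j, grows s As s' As', recorded s' As' i j &
    s' ntriples 0 <= (s ntriples 0).+1]).
Proof.
have [nH NH cH nnH frH] := H_bounds.
move=> bs st vi_s vj_s iM jM nt; have [inp fam _ _ _] := st.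
have T1 := runs_compare bs inp fam vi_s vj_s iM jM.
have MN : size As <= N by apply: leq_trans num_le; apply: sets_size; case: fam.
apply: runs_le.
  apply: (runs_seq T1) => s1 b1 [fr1 touchP meetP].
  have st1 : state s1 As by apply: (state_frame fr1) => //.
  have g1 : grows s As s1 As by apply: grows_refl => *; rewrite fr1.
  have vi1 : s1 vi 0 = i by rewrite fr1.
  have vj1 : s1 vj 0 = j by rewrite fr1.
  have nt1 : s1 ntriples 0 = s ntriples 0 by rewrite fr1.
  apply: (runs_if H2 HB (T := 400 * n.+1)) => //= test; last first.
    apply: runs_skip => //.
    exists As; split=> //; last by rewrite nt1.
    move=> /meetP m0 /touchP t0; move: test; rewrite m0; lia.
  have /touchP ad : s1 touch 0 <> 0 by nia.
  have /meetP dj : s1 meet 0 = 0 by nia.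
  set A := nth set0 As i :|: nth set0 As j.
  have [inp1 fam1 sing1 gd1 fc1] := st1.
  have [M1 fR1 _ _ [_ cs1]] := fam1; have [i0 _ _ _] := inp1.
  have cA : cset e A by apply: csetU => //; apply: cs1; apply: mem_nth.
  apply: runs_le.
    apply: (runs_seq (runs_insert b1 inp1 fam1 cA _ _ _ _ _ _ _ _)) => //.
    - move=> s2 k kn vu2 fr2 keep2.
      have ki : i * n + k < size As * n by apply: cell_lt.
      have kj : j * n + k < size As * n by apply: cell_lt.
      have ei : den s2 (Var vi [*] nV [+] Var vu) = i * n + k.
        by rewrite /= vu2 !fr2 // i0 vi1.
      have ej : den s2 (Var vj [*] nV [+] Var vu) = j * n + k.
        by rewrite /= vu2 !fr2 // i0 vj1.
      have [ri ni] := fR1 i k iM kn; have [rj nj] := fR1 j k jM kn.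
      have [r2i n2i] := keep2 _ ki; have [r2j n2j] := keep2 _ kj.
      rewrite -[den s2 (Cell rows _ [+] _)]/(s2 rows (den s2 (Var vi [*] nV [+] Var vu)) + s2 rows (den s2 (Var vj [*] nV [+] Var vu))).
      rewrite -[den s2 (Cell nbrs _ [+] _)]/(s2 nbrs (den s2 (Var vi [*] nV [+] Var vu)) + s2 nbrs (den s2 (Var vj [*] nV [+] Var vu))).
      rewrite ei ej r2i r2j n2i n2j ri rj ni nj bitU // -deginU //.
      split=> //; apply: leq_trans (ltnW nH); exact: degin_le.
    - have := frH (s ntriples 0) (ltnW nt); rewrite -nt1; lia.
    - by apply: leq_ltn_trans num_le _; lia.
    move=> s3 b3 [fam3 fr3 fc3 [l [lM el idx]]].
    have nt3 : s3 ntriples 0 = s ntriples 0 by rewrite fr3 // nt1.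
    apply: runs_le.
      apply: (@runs_set _ _ H2 HB (s ntriples 0) i) => //; first by rewrite /= fr3.
        by lia.
      move=> b4; apply: (@runs_set _ _ H2 HB (s ntriples 0) j) => //.
      - by rewrite /= /write /= fr3.
      - by lia.
      move=> b5; apply: (@runs_set _ _ H2 HB (s ntriples 0) l) => //.
      - by rewrite /= /write /= idx subn1.
      - have szM : size (add_set As A) <= N by apply: leq_trans num_le; apply: sets_size; case: fam3.
        by lia.
      move=> b6; apply: (@runs_set1 _ _ H2 HB 0 (s ntriples 0).+1 _ _ _ _ 10) => //.
      - by rewrite /= /write /= nt3 addn1.
      - by lia.
      set s4 := write _ _ _ _.
      have ext k : k < size As -> k < size (add_set As A) /\ nth set0 (add_set As A) k = nth set0 As k.
        move=> kM; rewrite /add_set; case: ifP => // _.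
        by rewrite size_rcons nth_rcons kM; split=> //; apply: leqW.
      have fr4 : frame [:: left; right; union; ntriples] s3 s4.
        by do 4 (apply: frame_write => //).
      have left4 q : q < s ntriples 0 -> s4 left q = s1 left q.
        by move=> qn; rewrite /s4 /write /= ifN ?fr3 //; apply/eqP; lia.
      have right4 q : q < s ntriples 0 -> s4 right q = s1 right q.
        by move=> qn; rewrite /s4 /write /= ifN ?fr3 //; apply/eqP; lia.
      have union4 q : q < s ntriples 0 -> s4 union q = s1 union q.
        by move=> qn; rewrite /s4 /write /= ifN ?fr3 //; apply/eqP; lia.
      have new4 : [/\ s4 left (s ntriples 0) = i, s4 right (s ntriples 0) = j &
          s4 union (s ntriples 0) = l].
        by rewrite /s4 /write /= eqxx.
      exists (add_set As A); split.
      - split.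
        + by apply: input_frame fr4 _ _ => //; apply: input_frame fr3 _ _.
        + by apply: family_frame fr4 _ _.
        + move=> k kn; have [kM <-] := sing1 k kn; exact: ext.
        + move=> q; have -> : s4 ntriples 0 = (s ntriples 0).+1 by [].
          rewrite ltnS leq_eqVlt => /orP[/eqP ->|qn]; rewrite /good.
            have [-> -> ->] := new4.
            have [k1 ->] := ext i iM; have [k2 ->] := ext j jM; by rewrite el; split.
          rewrite left4 // right4 // union4 //.
          have [|h1 h2 h3 h4 h5] := gd1 q; first by rewrite nt1.
          have [k1 ->] := ext _ h1; have [k2 ->] := ext _ h2; have [k3 ->] := ext _ h3.
          by split.
        + have -> : s4 ntriples 0 = (s ntriples 0).+1 by [].
          have -> : s4 fresh 0 = s3 fresh 0 by [].
          rewrite addnS mulnS; rewrite nt1 in fc1; lia.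
      - by split; rewrite /s4 /write /= fr3.
      - apply: (grows_trans g1); split=> //.
          by rewrite nt1 /s4 /write /=.
        by move=> q; rewrite nt1 => qn; rewrite left4 ?right4.
      - move=> _ _; exists (s ntriples 0); case: new4 => -> -> _; split=> //.
      - by [].
    by [].
  by rewrite /=; lia.
by rewrite /=; lia.
Qed.

Lemma state_size s As : state s As -> size As <= N.
Proof. by case=> _ [_ _ _ _ so] _ _ _; apply: leq_trans num_le; apply: sets_size. Qed.

Definition complete s As := forall i j, j <= i -> i < size As -> recorded s As i j.

Lemma runs_pairs s As : bounded s -> state s As -> s ntriples 0 = 0 ->
  runs Pairs s (N.+1 * (N.+1 * (700 * n.+1 + 30) + 30)) (fun s' => exists As',
    [/\ state s' As', complete s' As' & s' ntriples 0 <= N * N]).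
Proof.
have [nH NH cH nnH frH] := H_bounds.
move=> bs st nt0.
pose I i s' := exists As', [/\ state s' As', s' vi 0 = i, i <= size As',
  forall i' j, i' < i -> j <= i' -> recorded s' As' i' j & s' ntriples 0 <= i * N].
(* Round [i] tries [i + 1 <= N] pairs, so it records at most [N] triples. *)
have iN i : i < N -> (i * N + i.+1 <= N * N) /\ (i * N + i.+1 <= i.+1 * N).
  move=> lt; have h : i.+1 * N <= N * N by rewrite leq_mul2r lt orbT.
  by move: h; rewrite mulSn; lia.
apply: (runs_for (I := I) (m := N) H2 HB) => //; first by lia.
- exists As; split=> //.
  by rewrite mul0n -[write _ _ _ _ _ _]/(s ntriples 0) nt0.
- move=> k s1 b1 [As1 [st1 vk _ _ _]]; split=> //.
  rewrite -[den _ _]/(s1 nsets 0); case: (st1) => _ [-> _ _ _ _] _ _ _; exact: state_size st1.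
- move=> i s1 b1 [As1 [st1 vi1 _ rec1 nt1]].
  have -> : den s1 (Var nsets) = size As1 by case: st1 => _ [].
  move=> iM iN'; have [q1 q2] := iN i iN'.
  pose J j s' := exists As', [/\ state s' As', s' vi 0 = i /\ s' vj 0 = j,
    i < size As' /\ j <= i.+1,
    (forall i' j', i' < i -> j' <= i' -> recorded s' As' i' j') /\
    (forall j', j' < j -> recorded s' As' i j') & s' ntriples 0 <= i * N + j].
  apply: (runs_for (I := J) (m := N) H2 HB) => //; first by lia.
  + exists As1; split=> //.
    by rewrite addn0.
  + move=> j s2 b2 [As2 [st2 [vi2 vj2] [iM2 _] _ _]]; split=> //.
    by rewrite /= vi2 addn1; apply: leq_trans iM2 (state_size st2).
  + move=> j s2 b2 [As2 [st2 [vi2 vj2] [iM2 _] [rec2 rec2'] nt2]].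
    rewrite /= vi2 addn1 => ji _.
    have jM2 : j < size As2 by apply: leq_ltn_trans iM2.
    apply: runs_weaken (runs_pair b2 st2 vi2 vj2 iM2 jM2 _) _ _ => //; first by lia.
    move=> s3 b3 [As3 [st3 [vi3 vj3] g rec3 nt3]]; split=> //.
    have iM3 : i < size As3 by case: g => /(_ i iM2)[].
    exists As3; split=> //.
    * split=> [i' j' lt le|j'].
        apply: (@recorded_grows s2 As2 (write s3 vj 0 j.+1)) => //.
        - by apply: ltn_trans lt iM2.
        - by apply: leq_ltn_trans le _; apply: ltn_trans lt iM2.
        - exact: rec2.
      rewrite ltnS leq_eqVlt => /orP[/eqP -> //|lt].
      apply: (@recorded_grows s2 As2 (write s3 vj 0 j.+1)) => //.
      - exact: ltn_trans lt jM2.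
      - exact: rec2'.
    * by rewrite -[write _ _ _ _ _ _]/(s3 ntriples 0); lia.
  + move=> j s2 b2 [As2 [st2 [vi2 vj2] [iM2 ji] [rec2 rec2'] nt2]].
    rewrite /= vi2 addn1 => ij; split=> //; exists As2; split=> //.
    * move=> i' j' lt le; case: (ltnP i' i) => [li|gi]; first exact: rec2.
      have -> : i' = i by lia.
      by apply: rec2'; lia.
    * rewrite -[write _ _ _ _ _ _]/(s2 ntriples 0).
      by apply: leq_trans nt2 _; apply: leq_trans q2; lia.
- move=> i s1 b1 [As1 [st1 vi1 iM rec1 nt1]].
  have -> : den s1 (Var nsets) = size As1 by case: st1 => _ [].
  move=> Mi; exists As1; split=> //.
    by move=> i' j le lt; apply: rec1 => //; lia.
  by apply: leq_trans nt1 _; rewrite leq_mul2r (leq_trans iM (state_size st1)) orbT.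
Qed.

Definition Enumerate := fresh ::= Const 2 ;; Singletons ;; Pairs.

Lemma runs_enumerate s : bounded s -> input_ok s -> (forall a i, 2 < a -> s a i = 0) ->
  runs Enumerate s (3 + (n.+1 * (300 * n.+1 + 30) + N.+1 * (N.+1 * (700 * n.+1 + 30) + 30)))
    (fun s' => exists As', [/\ state s' As', complete s' As' & s' ntriples 0 <= N * N]).
Proof.
move=> bs inp z; apply: (@runs_set _ _ H2 HB 0 2) => // b1.
have fr1 : frame [:: fresh] s (write s fresh 0 2) by apply: frame_write.
have inp1 := input_frame fr1 isT inp.
have fam1 : family (write s fresh 0 2) [::].
  split=> //.
  - by rewrite fr1 // z.
  - by split=> // [x|x y]; rewrite fr1 // z.
  - by split=> // p; rewrite fr1 // z.
have T := runs_singletons b1 inp1 fam1 (erefl _).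
apply: (runs_seq T) => s2 b2 [fam2 fr2 fc2].
have nt2 : s2 ntriples 0 = 0 by rewrite fr2 // fr1 // z.
apply: (runs_pairs b2 (As := singles n)) => //; split=> //.
- exact: input_frame fr2 _ inp1.
- by move=> k kn; rewrite nth_singles // size_map size_iota.
- by rewrite nt2.
- by rewrite nt2 addn0.
Qed.

(** * The table of values and its relaxation *)

Definition cell l d := l * c + d.

Lemma cell_inj l d l' d' : d < c -> d' < c -> cell l d = cell l' d' -> l = l' /\ d = d'.
Proof.
rewrite /cell => dc d'c eq; have el : l = l'.
  have := congr1 (divn^~ c) eq; rewrite !divnMDl ?c_gt0 //.
  by rewrite !divn_small // !addn0.
by split=> //; move: eq; rewrite el => /addnI.
Qed.

Definition entry l d := l [*] nC [+] d.

(** The first [n] sets are the singletons, with exact values 0 or 1: in truncated subtraction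
    [1 - (1 - x)] turns a distance [x] of colour numbers into the test for being different. *)
Definition Init_values :=
  For vi (Var nsets) (For vd nC
    (If (nV [-] Var vi)
       (Store value (entry (Var vi) (Var vd))
          (Const 1 [-] (Const 1 [-] ((Var vd [-] Cell 2 (Var vi)) [+] (Cell 2 (Var vi) [-] Var vd)))))
       (Store value (entry (Var vi) (Var vd)) nV))).

Definition initial s l d := if l < n then nat_of_bool (d != s 2 l) else n.

Lemma runs_init s As : bounded s -> state s As ->
  runs Init_values s (N.+1 * (c.+1 * (60 + 30) + 30)) (fun s' =>
    [/\ frame [:: value; vi; vd] s s' &
     forall l d, l < size As -> d < c -> s' value (cell l d) = initial s l d]).
Proof.
have [nH NH cH nnH frH] := H_bounds.
move=> bs st; have [[i0 i1 _ _] [sz _ _ _ _] _ _ _] := st; have MN := state_size st.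
have NH' : N < H by lia.
pose I l s' := [/\ frame [:: value; vi; vd] s s', s' vi 0 = l, l <= size As &
  forall l' d, l' < l -> d < c -> s' value (cell l' d) = initial s l' d].
apply: (runs_for (I := I) (m := N) H2 HB) => //.
- by split=> //; apply: frame_write.
- by move=> l s1 _ [fr vi1 _ _]; split=> //; rewrite /= fr // sz.
- move=> l s1 b1 [fr1 vi1 _ val1]; rewrite /= fr1 // sz => lM _.
  pose J d s' := [/\ frame [:: value; vi; vd] s s', s' vi 0 = l, s' vd 0 = d /\ d <= c,
    (forall l' d, l' < l -> d < c -> s' value (cell l' d) = initial s l' d) &
    (forall d', d' < d -> s' value (cell l d') = initial s l d')].
  apply: (runs_for (I := J) (m := c) H2 HB) => //.
  + by split=> //; apply: frame_write.
  + by move=> d s2 _ [fr vi2 [vd2 dc] _ _]; split=> //; rewrite /= fr // i1.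
  + move=> d s2 b2 [fr vi2 [vd2 dc'] v1 v2] _ dc.
    have addr : den s2 (entry (Var vi) (Var vd)) = cell l d.
      by rewrite /entry /= vi2 vd2 fr // i1.
    have fin : s2 vd 0 = d /\ J d.+1 (write (write s2 value (cell l d) (initial s l d)) vd 0 d.+1).
      split=> //; split=> //.
      * by do 2 (apply: frame_write => //).
      * move=> l' d' lt d'c; rewrite /write /=; case: eqP => [/cell_inj[] // el _|_].
          by move: lt; rewrite el ltnn.
        exact: v1.
      * move=> d'; rewrite ltnS leq_eqVlt => /orP[/eqP ->|lt]; rewrite /write /= ?eqxx //.
        case: eqP => [/cell_inj[] //|_]; last exact: v2.
        * exact: ltn_trans lt dc.
        * by move=> _ ed; move: lt; rewrite ed ltnn.
    have e2 : s2 2 l = s 2 l by rewrite fr.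
    have e0 : s2 0 0 = n by rewrite fr.
    apply: runs_le; first apply: (runs_if H2 HB (T := 40)) => //= test.
    * apply: (@runs_set1 _ _ H2 HB (cell l d) (initial s l d)) => //.
        rewrite /= vi2 vd2 e2 /initial; move: test; rewrite e0 vi2 => test.
        by rewrite ifT; last lia; case: eqP => [->|]; lia.
      rewrite /initial; case: ifP => _; last exact: ltnW.
      by case: (_ != _) => /=; lia.
    * apply: (@runs_set1 _ _ H2 HB (cell l d) (initial s l d)) => //.
        rewrite /= e0 /initial; move: test; rewrite e0 vi2 => test.
        by rewrite ifF //; apply/negbTE; rewrite -leqNgt; lia.
      rewrite /initial; case: ifP => _; last exact: ltnW.
      by case: (_ != _) => /=; lia.
    * by [].
  + move=> d s2 b2 [fr vi2 [vd2 dc'] v1 v2]; rewrite /= fr // i1 => cd.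
    split=> //; split=> //; first by apply: frame_write.
    move=> l' d'; rewrite ltnS leq_eqVlt => /orP[/eqP -> dc|lt dc]; last exact: v1.
    by apply: v2; lia.
- move=> l s1 _ [fr vi1 _ val]; rewrite /= fr // sz => Ml; split=> //.
  by move=> l' d lM; apply: val; lia.
Qed.

(** In truncated subtraction [x - (x - y)] is the minimum of [x] and [y]. The new value never
    exceeds the old one, so cells stay bounded. *)
Definition Step :=
  let U := Cell union (Var vq) in
  let at_ x d := Cell value (entry x d) in
  Store value (entry U (Var vd)) (at_ U (Var vd) [-] (at_ U (Var vd) [-]
    (at_ (Cell left (Var vq)) (Var vd) [+] at_ (Cell right (Var vq)) (Var vd)))) ;;
  Store value (entry U (Var vd)) (at_ U (Var vd) [-] (at_ U (Var vd) [-]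
    (at_ U (Var vc) [+] Const 1))).

Definition Relax :=
  For vr (nV [+] nV) (For vq (Var ntriples) (For vd nC (For vc nC Step))).

(* The value [n], which no minimum exceeds, stands for infinity. *)
Definition sound s As := forall l d, l < size As -> d < c ->
  s value (cell l d) <= n /\ (s value (cell l d) < n ->
    deriv e (single w) (nth set0 As l) (clr d) (s value (cell l d))).

(** The end of a round is compared with its start. Updates are made in place, but values only
    decrease, so reading a value already updated in this round can only strengthen the
    inequalities. *)
Definition relaxed s s' q d d' :=
  s' value (cell (s union q) d) <= s value (cell (s left q) d) + s value (cell (s right q) d) /\
  s' value (cell (s union q) d) <= s value (cell (s union q) d') + 1.

Definition lower s s' := forall a, s' value a <= s value a.

Lemma sound_write s As l d x : sound s As -> l < size As -> d < c ->
  (x < n -> deriv e (single w) (nth set0 As l) (clr d) x) ->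
  sound (write s value (cell l d) (minn (s value (cell l d)) x)) As.
Proof.
move=> so lM dc Dx l' d' l'M d'c; rewrite /write /=; case: eqP => [/cell_inj[] // -> ->|_]; last exact: so.
have [le D] := so l d lM dc; split; first by rewrite geq_min le.
by rewrite /minn; case: ifP.
Qed.

Lemma runs_step s As q d d' : bounded s -> state s As -> sound s As ->
  q < s ntriples 0 -> s vq 0 = q -> s vd 0 = d -> s vc 0 = d' -> d < c -> d' < c ->
  runs Step s 200 (fun s' => [/\ frame [:: value] s s', sound s' As, lower s s' & relaxed s s' q d d']).
Proof.
have [nH NH cH nnH frH] := H_bounds.
move=> bs st so qn vq_s vd_s vc_s dc d'c; have [[i0 i1 _ _] _ _ gd _] := st.
have [iM jM lM [dj ad] eU] := gd q qn.
set i := s left q in iM dj ad eU; set j := s right q in jM dj ad eU; set l := s union q in lM eU.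
have [li Di] := so i d iM dc; have [lj Dj] := so j d jM dc; have [ll Dl] := so l d lM dc.
have minE x y : x - (x - y) = minn x y by rewrite /minn; case: ltnP; lia.
have addr s1 : frame [:: value] s s1 -> den s1 (entry (Cell union (Var vq)) (Var vd)) = cell l d.
  by move=> fr; rewrite /entry /= !fr // i1 vq_s vd_s.
apply: runs_le.
  set x := s value (cell i d) + s value (cell j d).
  apply: (@runs_set _ _ H2 HB (cell l d) (minn (s value (cell l d)) x)) => //.
  - exact: addr.
  - by rewrite /entry /= i1 vq_s vd_s minE.
  - by rewrite geq_min bs.
  move=> b1; set s1 := write _ _ _ _.
  have fr1 : frame [:: value] s s1 by apply: frame_write.
  have so1 : sound s1 As.
    apply: sound_write => // xn; rewrite eU; apply: DJoin => //.
      by apply: Di; rewrite /x in xn; lia.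
    by apply: Dj; rewrite /x in xn; lia.
  have lo1 : lower s s1.
    by move=> a; rewrite /s1 /write /=; case: eqP => [->|_] //; rewrite geq_minl.
  set y := s1 value (cell l d') + 1.
  have v1 : s1 value (cell l d) = minn (s value (cell l d)) x by rewrite /s1 /write /= eqxx.
  apply: (@runs_set1 _ _ H2 HB (cell l d) (minn (s1 value (cell l d)) y) _ _ _ _ 90) => //.
  - exact: addr.
  - rewrite -[LHS]/(s1 value (den s1 (entry (Cell union (Var vq)) (Var vd))) -
      (s1 value (den s1 (entry (Cell union (Var vq)) (Var vd))) -
      (s1 value (den s1 (entry (Cell union (Var vq)) (Var vc))) + 1))).
    rewrite addr // minE (_ : den s1 (entry (Cell union (Var vq)) (Var vc)) = cell l d') //.
    by rewrite /entry /= !fr1 // i1 vq_s vc_s.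
  - by rewrite geq_min b1.
  split.
  - by do 2 (apply: frame_write => //).
  - apply: sound_write => // yn; rewrite /y addn1; apply: (@DRecolour _ _ _ _ _ (clr d')).
    by have [_] := so1 l d' lM d'c; apply; rewrite /y in yn; lia.
  - move=> a; rewrite /write /=; case: eqP => [->|_]; last exact: lo1.
    by rewrite geq_min lo1.
  - rewrite /relaxed -/i -/j -/l /write /= eqxx; split; first by rewrite v1 -minnA geq_min geq_min leqnn orbT.
    apply: leq_trans (geq_minr _ _) _; rewrite /y leq_add2r; exact: lo1.
by [].
Qed.

Definition round_vars := [:: value; vq; vd; vc].

Lemma relaxed_lower s0 s s' q d d' : frame round_vars s0 s ->
  lower s0 s -> relaxed s s' q d d' -> relaxed s0 s' q d d'.
Proof.
move=> E lo; rewrite /relaxed (E union) // (E left) // (E right) // => -[r1 r2]; split.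
  by apply: leq_trans r1 _; apply: leq_add; apply: lo.
by apply: leq_trans r2 _; rewrite leq_add2r; apply: lo.
Qed.

(** [R] selects the triples and colour pairs already treated; for the three nested loops it is an
    initial segment of the lexicographic order. *)
Definition round_inv s0 As (R : nat -> nat -> nat -> Prop) s := [/\ frame round_vars s0 s,
  sound s As, lower s0 s & forall q d d', q < s0 ntriples 0 -> d < c -> d' < c ->
    R q d d' -> relaxed s0 s q d d'].

Lemma round_inv_sub s0 As (R R' : nat -> nat -> nat -> Prop) s :
  (forall q d d', q < s0 ntriples 0 -> d < c -> d' < c -> R' q d d' -> R q d d') ->
  round_inv s0 As R s -> round_inv s0 As R' s.
Proof. by move=> sub [? ? ? r]; split=> // q d d' qn dc d'c /sub - /(_ qn dc d'c); apply: r. Qed.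

Lemma runs_round s0 As : bounded s0 -> state s0 As -> sound s0 As -> s0 ntriples 0 <= N * N ->
  runs (For vq (Var ntriples) (For vd nC (For vc nC Step))) s0
    ((N * N).+1 * (c.+1 * (c.+1 * (200 + 30) + 30) + 30))
    (round_inv s0 As (fun _ _ _ => True)).
Proof.
have [nH NH cH nnH frH] := H_bounds.
move=> bs st so ntN; have [[i0 i1 _ _] _ _ _ _] := st.
have NNH : N * N < H by nia.
pose I q s := round_inv s0 As (fun q' _ _ => q' < q) s /\ s vq 0 = q.
apply: (runs_for (I := I) (m := N * N) H2 HB) => //.
- by split=> //; split=> //; apply: frame_write.
- by move=> q s _ [[fr _ _ _] ->]; rewrite /= fr.
- move=> q s1 b1 [inv1 vq1]; have [fr1 so1 _ _] := inv1; rewrite /= fr1 // => qn _.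
  pose J d s := [/\ round_inv s0 As (fun q' d' _ => q' < q \/ (q' = q /\ d' < d)) s, s vq 0 = q & s vd 0 = d].
  apply: (runs_for (I := J) (m := c) H2 HB) => //.
  + split=> //.
    apply: (@round_inv_sub _ _ (fun q' _ _ => q' < q)) => [q' d d' _ _ _ [//|[_ //]]|].
    by case: inv1 => fr ? ? ?; split=> //; apply: frame_write.
  + by move=> d s _ [[fr _ _ _] _ ->]; rewrite /= fr // i1.
  + move=> d s2 b2 [inv2 vq2 vd2]; have [fr2 so2 _ _] := inv2; rewrite /= fr2 // i1 => dc _.
    pose K d' s := [/\ round_inv s0 As (fun q1 d1 d2 => q1 < q \/ (q1 = q /\ (d1 < d \/ (d1 = d /\ d2 < d')))) s,
      s vq 0 = q, s vd 0 = d & s vc 0 = d'].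
    apply: (runs_for (I := K) (m := c) H2 HB) => //.
    * split=> //.
      apply: (@round_inv_sub _ _ (fun q' d' _ => q' < q \/ (q' = q /\ d' < d))) => [q' d1 d' _ _ _ [|[? []]]|]; auto.
        by case.
      by case: inv2 => fr ? ? ?; split=> //; apply: frame_write.
    * by move=> d' s _ [[fr _ _ _] _ _ ->]; rewrite /= fr // i1.
    * move=> d' s3 b3 [inv3 vq3 vd3 vc3]; have [fr3 so3 lo3 rel3] := inv3.
      rewrite /= fr3 // i1 => d'c _.
      have st3 : state s3 As by apply: (state_frame fr3).
      apply: runs_weaken (runs_step b3 st3 so3 _ vq3 vd3 vc3 dc d'c) (leqnn _) _; first by rewrite fr3.
      move=> s4 b4 [fr4 so4 lo4 rel4]; split; first by rewrite fr4.
      have fr5 : frame round_vars s3 s4.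
        by apply: frame_sub fr4 => x; rewrite !inE => /eqP ->.
      split; rewrite /write /= ?fr4 //.
      split=> //.
      - by apply: frame_write => //; apply: frame_trans fr3 _.
      - by move=> a; apply: leq_trans (lo4 a) (lo3 a).
      - move=> q1 d1 d2 q1n d1c d2c R.
        have [[eq1 [ed1 ed2]]|ne] : (q1 = q /\ d1 = d /\ d2 = d') \/
            (q1 < q \/ (q1 = q /\ (d1 < d \/ (d1 = d /\ d2 < d')))) by lia.
          subst q1 d1 d2; exact: relaxed_lower rel4.
        have [r1 r2] := rel3 q1 d1 d2 q1n d1c d2c ne.
        by split; [apply: leq_trans r1|apply: leq_trans r2]; apply: lo4.
    * move=> d' s3 b3 [inv3 vq3 vd3 vc3]; have [fr3 _ _ _] := inv3; rewrite /= fr3 // i1 => cd'.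
      split=> //; split=> //.
      apply: (@round_inv_sub _ _ (fun q1 d1 d2 => q1 < q \/ (q1 = q /\ (d1 < d \/ (d1 = d /\ d2 < d'))))).
        by move=> q1 d1 d2 q1n d1c d2c; lia.
      by case: inv3 => fr ? ? ?; split=> //; apply: frame_write.
  + move=> d s2 b2 [inv2 vq2 vd2]; have [fr2 _ _ _] := inv2; rewrite /= fr2 // i1 => cd.
    split=> //; split=> //.
    apply: (@round_inv_sub _ _ (fun q1 d1 d2 => q1 < q \/ (q1 = q /\ d1 < d))).
      by move=> q1 d1 d2 q1n d1c d2c; lia.
    by case: inv2 => fr ? ? ?; split=> //; apply: frame_write.
- move=> q s1 b1 [inv1 vq1]; have [fr1 _ _ _] := inv1; rewrite /= fr1 // => nq.
  by apply: round_inv_sub inv1 => q' d d' q'n _ _ _; lia.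
Qed.

(** * Convergence of the rounds *)

Lemma deriv_nonempty A d k : deriv e (single w) A d k -> A != set0.
Proof.
elim=> {A d k} [A d [v [-> _]]|//|A A' d k j _ /set0Pn[x xA] _ _ _ _].
  by apply/set0Pn; exists v; rewrite set11.
by apply/set0Pn; exists x; rewrite inE xA.
Qed.

(* Derivations whose last step is not a recolouring. *)
Definition settled A d k := (single w A d /\ k = 0) \/
  exists A1 A2 k1 k2, [/\ deriv e (single w) A1 d k1, deriv e (single w) A2 d k2,
    [disjoint A1 & A2] /\ adj e A1 A2, A = A1 :|: A2 & k = k1 + k2].

(** Of several consecutive recolourings of the same set only the last matters, so one use of the
    recolouring rule after a settled derivation is enough. *)
Lemma deriv_settled A d k : deriv e (single w) A d k ->
  settled A d k \/ exists d' k', k' < k /\ settled A d' k'.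
Proof.
elim=> {A d k} [A d LA|A d d' k D IH|A A' d k j D1 _ D2 _ dj ad].
- by left; left.
- right; case: IH => [S|[d1 [k1 [lt S]]]]; first by exists d, k.
  by exists d1, k1; split=> //; apply: leqW.
- by left; right; exists A, A', k, j.
Qed.

Lemma join_card A1 A2 d1 d2 k1 k2 : deriv e (single w) A1 d1 k1 ->
  deriv e (single w) A2 d2 k2 -> [disjoint A1 & A2] ->
  #|A1| < #|A1 :|: A2| /\ #|A2| < #|A1 :|: A2|.
Proof.
move=> D1 D2 dj; rewrite cardsU (disjoint_setI0 dj) cards0 subn0.
move: (deriv_nonempty D1) (deriv_nonempty D2); rewrite -!card_gt0; lia.
Qed.

Lemma settled_leaf A d k : settled A d k -> #|A| <= 1 -> single w A d /\ k = 0.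
Proof.
case=> [//|[A1 [A2 [k1 [k2 [D1 D2 [dj _] -> _]]]]]].
have := join_card D1 D2 dj; have := deriv_nonempty D1; rewrite -card_gt0; lia.
Qed.

Lemma clr_surj d : exists2 m, m < c & clr m = d.
Proof.
exists (enum_rank d); first by rewrite -card_C ltn_ord.
by rewrite /clr nth_enum_rank.
Qed.

Lemma clr_inj i j : i < c -> j < c -> clr i = clr j -> i = j.
Proof.
move=> ic jc /eqP; rewrite /clr nth_uniq ?enum_uniq -?cardE ?card_C //; exact: eqP.
Qed.

Lemma complete_triple s As A1 A2 : state s As -> complete s As -> A1 \in As -> A2 \in As ->
  [disjoint A1 & A2] -> adj e A1 A2 -> exists q, q < s ntriples 0 /\
  [/\ nth set0 As (s union q) = A1 :|: A2, s union q < size As,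
    s left q < size As /\ s right q < size As &
    (nth set0 As (s left q) = A1 /\ nth set0 As (s right q) = A2) \/
    (nth set0 As (s left q) = A2 /\ nth set0 As (s right q) = A1)].
Proof.
move=> st co A1s A2s dj ad; have [_ _ _ gd _] := st.
have i1 : seq.index A1 As < size As by rewrite index_mem.
have i2 : seq.index A2 As < size As by rewrite index_mem.
have e1 := nth_index set0 A1s; have e2 := nth_index set0 A2s.
case: (leqP (seq.index A2 As) (seq.index A1 As)) => [le|/ltnW le].
  have [||q [qn el er]] := co _ _ le i1; rewrite ?e1 ?e2 //.
  exists q; split=> //; have [h1 h2 h3 _ ->] := gd q qn.
  by rewrite el er e1 e2 in h1 h2 *; split=> //; left.
have [||q [qn el er]] := co _ _ le i2; rewrite ?e1 ?e2 1?disjoint_sym //; first exact: adjC.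
exists q; split=> //; have [h1 h2 h3 _ ->] := gd q qn.
by rewrite el er e1 e2 setUC in h1 h2 *; split=> //; right.
Qed.

(** Singletons are listed, and the list is closed under joins of disjoint adjacent members, the only
    step by which a derivation forms a larger set. *)
Lemma deriv_listed s As A d k : state s As -> complete s As ->
  deriv e (single w) A d k -> A \in As.
Proof.
move=> st co; elim=> {A d k} [A d [v [-> _]]|//|A A' d k j _ As1 _ As2 dj ad].
  have [_ _ sing _ _] := st; have [i ni <-] := vtx_surj v.
  by have [lt <-] := sing i ni; apply: mem_nth.
have [q [_ [<- lt _ _]]] := complete_triple st co As1 As2 dj ad.
exact: mem_nth.
Qed.

(* A recolouring and a join each take a round, hence twice the cardinal. *)
Definition progress r s As := forall l d k, l < size As -> d < c ->
  (deriv e (single w) (nth set0 As l) (clr d) k -> 2 * #|nth set0 As l| <= r + 2 ->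
     s value (cell l d) <= k) /\
  (settled (nth set0 As l) (clr d) k -> 2 * #|nth set0 As l| <= r + 3 ->
     s value (cell l d) <= k).

Lemma settled_deriv A d k : settled A d k -> deriv e (single w) A d k.
Proof.
by case=> [[LA ->]|[A1 [A2 [k1 [k2 [D1 D2 [dj ad] -> ->]]]]]]; [apply: DLeaf | apply: DJoin].
Qed.

Lemma progress0 s s' As : state s As ->
  (forall l d, l < size As -> d < c -> s' value (cell l d) = initial s l d) -> progress 0 s' As.
Proof.
move=> st val l d k lM dc.
have base : deriv e (single w) (nth set0 As l) (clr d) k -> #|nth set0 As l| <= 1 -> s' value (cell l d) <= k.
  move=> D A1; have [[_ _ _ i3] [_ _ _ _ [uA _]] sing _ _] := st.
  have /cards1P[v ev] : #|nth set0 As l| == 1.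
    by rewrite eqn_leq A1 card_gt0 (deriv_nonempty D).
  have [j jn ej] := vtx_surj v; have [jM sj] := sing j jn.
  have ejl : j = l by apply/eqP; rewrite -(nth_uniq set0 jM lM uA) sj ej ev.
  subst j; rewrite val // /initial jn; have [s2c cw] := i3 l jn.
  (* A derivation that is not settled costs at least 1, and no initial entry of a singleton is
     larger. *)
  case: (deriv_settled D) => [S|[d' [k' [lt _]]]]; last by case: (_ != _) => //=; lia.
  have [[u [eu cu]] ->] := settled_leaf S A1.
  have eul : u = vtx l by apply: set1_inj; rewrite -eu ev ej.
  rewrite leqn0 eqb0 negbK; apply/eqP; apply: clr_inj => //.
  by rewrite cw cu eul.
split=> [D le|S le]; first by apply: base => //; lia.
by apply: base; [apply: settled_deriv | lia].
Qed.

Lemma progress_round r s s' As : state s As -> complete s As -> progress r s As ->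
  round_inv s As (fun _ _ _ => True) s' -> progress r.+1 s' As.
Proof.
move=> st co pr [fr so lo rel] l d k lM dc.
have triple A1 A2 : A1 \in As -> A2 \in As -> [disjoint A1 & A2] -> adj e A1 A2 ->
    nth set0 As l = A1 :|: A2 -> exists q, [/\ q < s ntriples 0, s union q = l,
    s left q < size As /\ s right q < size As &
    (nth set0 As (s left q) = A1 /\ nth set0 As (s right q) = A2) \/
    (nth set0 As (s left q) = A2 /\ nth set0 As (s right q) = A1)].
  move=> in1 in2 dj ad eA.
  have [q [qn [eU UM sM or]]] := complete_triple st co in1 in2 dj ad.
  exists q; split=> //; have [_ [_ _ _ _ [uA _]] _ _ _] := st.
  by apply/eqP; rewrite -(nth_uniq set0 UM lM uA) eU eA.
have second k' : settled (nth set0 As l) (clr d) k' -> 2 * #|nth set0 As l| <= r + 4 ->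
    s' value (cell l d) <= k'.
  case=> [[LA k0] le|[A1 [A2 [k1 [k2 [D1 D2 [dj ad] eA ek]]]]] le].
    apply: leq_trans (lo _) _; apply: (pr l d k' lM dc).1; first by rewrite k0; apply: DLeaf.
    by case: LA => v [-> _]; rewrite cards1; lia.
  have in1 := deriv_listed st co D1; have in2 := deriv_listed st co D2.
  have [q [qn eU [LM RM] or]] := triple _ _ in1 in2 dj ad eA.
  have [c1 c2] := join_card D1 D2 dj; rewrite -eA in c1 c2.
  have [r1 _] := rel q d d qn dc dc I; rewrite eU in r1.
  apply: leq_trans r1 _; rewrite ek.
  case: or => -[eL eR]; last rewrite addnC.
    apply: leq_add.
      by apply: (pr _ d k1 LM dc).1; rewrite eL //; lia.
    by apply: (pr _ d k2 RM dc).1; rewrite eR //; lia.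
  apply: leq_add.
    by apply: (pr _ d k1 RM dc).1; rewrite eR //; lia.
  by apply: (pr _ d k2 LM dc).1; rewrite eL //; lia.
split=> [D le|S le]; last by apply: second => //; lia.
case: (deriv_settled D) => [S|[d' [k' [lt S]]]]; first by apply: second => //; lia.
(* The rules are relaxed only at unions of triples, and a singleton is no such union; its entries
   were right from the start. *)
case: (leqP #|nth set0 As l| 1) => [le1|gt1].
  by apply: leq_trans (lo _) _; apply: (pr l d k lM dc).1 => //; lia.
have [m mc em] := clr_surj d'; rewrite -em in S.
have prm := (pr l m k' lM mc).2 S; case: S => [[[v [ev _]] _]|].
  by move: gt1; rewrite ev cards1.
move=> [A1 [A2 [k1 [k2 [D1 D2 [dj ad] eA ek]]]]].
have in1 := deriv_listed st co D1; have in2 := deriv_listed st co D2.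
(* Any triple with this union will do: it is needed only so that the recolouring rule is applied to
   this set during the round. *)
have [q [qn eU _ _]] := triple _ _ in1 in2 dj ad eA.
have [_ r2] := rel q d m qn dc mc I; rewrite eU in r2.
apply: leq_trans r2 _; rewrite addn1; apply: leq_trans lt; rewrite ltnS.
by apply: prm; lia.
Qed.

Lemma sound0 s s' As : state s As ->
  (forall l d, l < size As -> d < c -> s' value (cell l d) = initial s l d) -> sound s' As.
Proof.
move=> st val l d lM dc; rewrite val // /initial.
have n0 := n_gt0; have [[_ _ _ i3] _ sing _ _] := st.
case: ifP => [ln|_]; last by rewrite leqnn ltnn.
have [_ ->] := sing l ln; have [s2c cw] := i3 l ln.
split; first by case: (_ != _).
case: eqP => [->|_] _ /=; first by apply: DLeaf; exists (vtx l).
by apply: (@DRecolour _ _ _ _ _ (w (vtx l))); apply: DLeaf; exists (vtx l).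
Qed.

Lemma runs_relax s As : bounded s -> state s As -> complete s As -> s ntriples 0 <= N * N ->
  sound s As -> progress 0 s As ->
  runs Relax s ((2 * n).+1 * ((N * N).+1 * (c.+1 * (c.+1 * (200 + 30) + 30) + 30) + 30))
    (fun s' => [/\ frame (vr :: round_vars) s s', sound s' As & progress (2 * n) s' As]).
Proof.
have [nH NH cH nnH frH] := H_bounds; have n0 := n_gt0.
have n2H : 2 * n < H by have := frH 0 isT; lia.
move=> bs st co nt so pr.
pose I r s' := [/\ frame (vr :: round_vars) s s', s' vr 0 = r, r <= 2 * n, sound s' As & progress r s' As].
have i0 s' : frame (vr :: round_vars) s s' -> s' 0 0 = n.
  by move=> fr; rewrite fr //; case: st => -[].
apply: (runs_for (I := I) (m := 2 * n) H2 HB) => //.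
- by split=> //; apply: frame_write.
- by move=> r s1 _ [fr -> _ _ _]; rewrite /= i0 //; split=> //; lia.
- move=> r s1 b1 [fr1 vr1 _ so1 pr1] _ rn.
  have st1 : state s1 As by apply: (state_frame fr1).
  have nt1 : s1 ntriples 0 = s ntriples 0 by rewrite fr1.
  have co1 : complete s1 As.
    move=> i j ji iM; apply: (@recorded_grows s As) (co i j ji iM) => //.
      by apply: grows_refl => *; rewrite fr1.
    exact: leq_ltn_trans ji iM.
  apply: runs_weaken (runs_round b1 st1 so1 _) _ _ => //; first by rewrite nt1.
  move=> s2 b2 ri; have pr2 := progress_round st1 co1 pr1 ri.
  case: ri => fr2 so2 lo2 _; split; first by rewrite fr2.
  split=> //; apply: frame_write => //; apply: frame_trans fr1 _.
  by apply: frame_sub fr2 => x xX; rewrite inE xX orbT.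
- move=> r s1 b1 [fr1 vr1 rn so1 pr1]; rewrite /= i0 // => nr.
  by have er : r = 2 * n; [lia | rewrite er in pr1].
Qed.

(** * Reading off the answers *)

Definition result := Cell value (entry (Cell index (Var node) [-] Const 1) (Var vd)).

(** The insertion is a lookup of the full vertex set, which is already listed, so its dummy
    neighbour counts never become permanent. The start value [nV] is the default of the iterated
    minimum in [min_moves]. *)
Definition Output :=
  Insert (Const 1) (Const 0) ;;
  answer ::= nV ;;
  For vd nC (
    Store answers (Var vd) result ;;
    answer ::= Var answer [-] (Var answer [-] result)).

Lemma table_min_moves s As l d : graph_connected e -> sound s As -> progress (2 * n) s As ->
  l < size As -> nth set0 As l = setT -> d < c ->
  s value (cell l d) = min_moves_to e w (clr d).
Proof.
move=> ce so pr lM eT dc; have [le D] := so l d lM dc.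
have least k : deriv e (single w) setT (clr d) k -> s value (cell l d) <= k.
  by move=> Dk; apply: (pr l d k lM dc).1; rewrite eT // cardsT card_V; lia.
apply: min_moves_deriv => //.
have [lt|ge] := ltnP (s value (cell l d)) n; first by rewrite -eT; apply: D.
(* The entry is still [n], standing for infinity; but [n] moves always suffice, so the optimum is at
   most [n], while [least] makes it at least [n]. *)
have /existsP[t /eqP pt] := floodable_card e w (clr d).
have [k kt Dk] := deriv_of_play e_sym ce pt.
rewrite size_tuple card_V in kt; have := least k Dk.
by move=> lk; have -> : s value (cell l d) = k by lia.
Qed.

Lemma runs_output s As : graph_connected e -> bounded s -> state s As -> sound s As ->
  progress (2 * n) s As -> setT \in As -> s ntriples 0 <= N * N ->
  runs Output s (300 * n.+1 + (4 + c.+1 * (100 + 30))) (correct_output e w).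
Proof.
have [nH NH cH nnH frH] := H_bounds.
move=> ce bs st so pr Tin nt; have [inp fam _ _ fc] := st.
apply: (runs_seq (runs_insert bs inp fam (A := setT) _ _ _ _ _ _ _ _ _)) => //.
- by case: fam => _ _ _ _ [_]; apply.
- move=> s' k kn _ _ _; split=> //; first by rewrite /bit inE.
  by rewrite Tin.
- have := frH _ nt; lia.
- by apply: leq_ltn_trans num_le _; lia.
move=> s1 b1 [fam1 fr1 _ [l [lM el idx]]].
rewrite /add_set Tin in lM el.
have val d : d < c -> s1 value (cell l d) = min_moves_to e w (clr d).
  by move=> dc; rewrite fr1 //; apply: (table_min_moves ce so pr).
have [i0 i1 _ _] := input_frame fr1 isT inp.
pose J k s' := [/\ frame [:: answers; answer; vd] s1 s', s' vd 0 = k, k <= c,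
  forall d, d < k -> s' answers d = min_moves_to e w (clr d) &
  (forall d, d < k -> s' answer 0 <= min_moves_to e w (clr d)) /\
  (s' answer 0 = n \/ exists2 d, d < k & s' answer 0 = min_moves_to e w (clr d))].
apply: (@runs_set _ _ H2 HB 0 n) => //; first exact: ltnW.
move=> b2; apply: (runs_for (I := J) (m := c) H2 HB) => //.
- split=> //; first by do 2 (apply: frame_write => //).
  by split=> //; left.
- by move=> k s' _ [fr -> _ _ _]; rewrite /= fr // i1.
- move=> k s' b' [fr vd' _ ans [amin aex]]; rewrite /= fr // i1 => kc _.
  have res s2 : frame [:: answers; answer] s' s2 -> den s2 result = min_moves_to e w (clr k).
    move=> fr2; rewrite -val // /result /entry /=.
    have F a i : a \notin [:: answers; answer; vd] -> s2 a i = s1 a i.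
      by move=> na; rewrite fr2 ?fr //; apply: contra na; rewrite !inE => /orP[] ->; rewrite ?orbT.
    by rewrite (F node) // (F index) // idx (F 0) // i1 subn1 (fr2 vd) // vd' F.
  have vN := min_moves_to_le_card e w (clr k); rewrite card_V in vN.
  apply: runs_le.
    apply: (@runs_set _ _ H2 HB k (min_moves_to e w (clr k))) => //.
    - exact: res.
    - exact: leq_trans vN (ltnW nH).
    move=> b3; set s3 := write _ _ _ _.
    apply: (@runs_set1 _ _ H2 HB 0 (minn (s' answer 0) (min_moves_to e w (clr k))) _ _ _ _ 40) => //.
    - rewrite -[LHS]/(s' answer 0 - (s' answer 0 - den s3 result)) res; last by apply: frame_write.
      by rewrite /minn; case: ltnP; lia.
    - by rewrite geq_min b'.
    split=> //; split=> //.
    - by do 3 (apply: frame_write => //).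
    - move=> d; rewrite ltnS leq_eqVlt /s3 /write /= => /orP[/eqP ->|lt]; first by rewrite eqxx.
      by rewrite ifN ?ans //; apply/eqP; lia.
    - rewrite /write /=; split=> [d|].
        by rewrite ltnS leq_eqVlt geq_min => /orP[/eqP ->|/amin ->]; rewrite ?leqnn ?orbT.
      rewrite /minn; case: ifP => _; last by right; exists k.
      by case: aex => [|[d dk ed]]; [left | right; exists d => //; apply: leqW].
  by [].
- move=> k s' b' [fr vd' kc ans [amin aex]]; rewrite /= fr // i1 => ck.
  have ek : k = c by lia.
  rewrite {k vd' kc ck}ek in ans amin aex; have clrE d : clr (enum_rank d) = d by rewrite /clr nth_enum_rank.
  have rk (d : C) : enum_rank d < c by rewrite -card_C ltn_ord.
  split=> [d|]; first by rewrite ans ?rk // clrE.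
  apply/eqP; rewrite eqn_leq; apply/andP; split.
    have [d0 ->] := min_moves_attained e w (w v0).
    by have := amin _ (rk d0); rewrite clrE.
  case: aex => [->|[d dc ->]]; last exact: min_moves_le.
  apply: leq_trans (min_moves_le e w (w v0)) _.
  by rewrite -card_V; apply: min_moves_to_le_card.
Qed.

Definition Program := Enumerate ;; Init_values ;; Relax ;; Output.

Definition program_time :=
  3 + (n.+1 * (300 * n.+1 + 30) + N.+1 * (N.+1 * (700 * n.+1 + 30) + 30)) +
  (N.+1 * (c.+1 * (60 + 30) + 30) +
  ((2 * n).+1 * ((N * N).+1 * (c.+1 * (c.+1 * (200 + 30) + 30) + 30) + 30) +
  (300 * n.+1 + (4 + c.+1 * (100 + 30))))).

Lemma runs_program s : graph_connected e -> bounded s -> input_ok s ->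
  (forall a i, 2 < a -> s a i = 0) ->
  runs Program s program_time (correct_output e w).
Proof.
move=> ce bs inp z; apply: (runs_seq (runs_enumerate bs inp z)).
move=> s1 b1 [As [st1 co1 nt1]].
apply: (runs_seq (runs_init b1 st1)) => s2 b2 [fr2 val2].
have st2 : state s2 As by apply: (state_frame fr2).
have nt2 : s2 ntriples 0 <= N * N by rewrite fr2.
have co2 : complete s2 As.
  move=> i j ji iM; apply: (@recorded_grows s1 As) (co1 i j ji iM) => //.
    by apply: grows_refl => *; rewrite fr2.
  exact: leq_ltn_trans ji iM.
apply: (runs_seq (runs_relax b2 st2 co2 nt2 (sound0 st1 val2) (progress0 st1 val2))).
move=> s3 b3 [fr3 so3 pr3].
have st3 : state s3 As by apply: (state_frame fr3).
apply: (runs_output ce b3 st3 so3 pr3); last by rewrite fr3.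
(* As the graph is connected, the full vertex set has a derivation for some colour, and any colour
   serves to show that it is listed. *)
have [k D] := deriv_exists e_sym w (w v0) ce.
exact: deriv_listed st2 co2 D.
Qed.

End Bounds.
End Verification.

(** * Running time and word size *)

Lemma nth_allpairs (S T : Type) (f : S -> T -> nat) x0 y0 (r : seq S) (q : seq T) a b :
  a < size r -> b < size q ->
  nth 0 [seq f u v | u <- r, v <- q] (a * size q + b) = f (nth x0 r a) (nth y0 q b).
Proof.
move=> ar bq; elim: r a ar => [|u r IH] [|a] //= ar; rewrite nth_cat size_map.
  by rewrite mul0n add0n bq (nth_map y0).
by rewrite mulSn -addnA ltnNge leq_addr /= addKn IH.
Qed.

(** The requirement [24 < K] serves the word size: cells are bounded by a cube, and expressions in
    them have degree at most 8. The dominant time is that of the relaxation, of order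
    [n * N ^ 2 * c ^ 2], together with the enumeration, of order [n * N ^ 2]. *)
Lemma program_time_bound : exists2 K, 24 < K &
  forall n c N, n <= N -> 0 < N -> 0 < c -> program_time n c N <= K * (c ^ 3 * N ^ 3).
Proof.
(* The coefficients of the four products estimated below add up to 13780, and the remaining terms
   contribute at most 867. *)
exists (150 * 100) => // n c N nN N0 c0; rewrite /program_time.
have NN : N <= N * N by rewrite leq_pmulr.
have cc : c <= c * c by rewrite leq_pmulr.
have t1 : n.+1 * (300 * n.+1 + 30) <= (2 * 630) * (N * N).
  by rewrite -mulnACA; apply: leq_mul; lia.
have t2 : N.+1 * (N.+1 * (700 * n.+1 + 30) + 30) <= (2 * 2900) * (N * (N * N)).
  rewrite -mulnACA; apply: leq_mul; first by lia.
  have u : N.+1 * (700 * n.+1 + 30) <= (2 * 1430) * (N * N).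
    by rewrite -mulnACA; apply: leq_mul; lia.
  by move: (_ * _) u => x; move: (N * N) NN N0 {t1}; lia.
have t3 : N.+1 * (c.+1 * (60 + 30) + 30) <= (2 * 210) * (N * c).
  by rewrite -mulnACA; apply: leq_mul; lia.
have t4 : (2 * n).+1 * ((N * N).+1 * (c.+1 * (c.+1 * (200 + 30) + 30) + 30) + 30) <=
    (3 * 2100) * (N * (N * N * (c * c))).
  rewrite -mulnACA; apply: leq_mul; first by lia.
  have u1 : c.+1 * (c.+1 * (200 + 30) + 30) <= (2 * 490) * (c * c).
    by rewrite -mulnACA; apply: leq_mul; lia.
  have u2 : (N * N).+1 * (c.+1 * (c.+1 * (200 + 30) + 30) + 30) <= (2 * 1010) * (N * N * (c * c)).
    rewrite -mulnACA; apply: leq_mul; first by lia.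
    by move: (c.+1 * _) u1 => x; move: (c * c) cc c0; clear; lia.
  have : 0 < N * N * (c * c) by rewrite !muln_gt0 N0 c0.
  by move: (_ * _) u2 => x; move: (N * N * _); clear; lia.
have N3 : N * N <= N ^ 3 by rewrite -[N * N]/(N ^ 2) leq_pexp2l.
have c3 : c * c <= c ^ 3 by rewrite -[c * c]/(c ^ 2) leq_pexp2l.
have mono x y : x <= c ^ 3 -> y <= N ^ 3 -> x * y <= c ^ 3 * N ^ 3 by apply: leq_mul.
have m1 : 1 * 1 <= c ^ 3 * N ^ 3 by apply: mono; rewrite expn_gt0 ?c0 ?N0.
have m2 : 1 * (N * N) <= c ^ 3 * N ^ 3 by apply: mono; rewrite // expn_gt0 c0.
have m3 : 1 * N ^ 3 <= c ^ 3 * N ^ 3 by apply: mono; rewrite // expn_gt0 c0.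
have m4 : c * N <= c ^ 3 * N ^ 3 by apply: mono; [apply: leq_trans c3 | apply: leq_trans N3].
have m5 : (c * c) * N ^ 3 <= c ^ 3 * N ^ 3 by apply: mono.
have m6 : c * 1 <= c ^ 3 * N ^ 3 by apply: mono; [apply: leq_trans c3 | rewrite expn_gt0 N0].
have e3 : N * (N * N) = N ^ 3 by rewrite !expnS expn0 muln1.
rewrite e3 in t2; rewrite (mulnA N) e3 (mulnC (N ^ 3)) in t4; rewrite [N * c]mulnC in t3.
rewrite !mul1n ?muln1 in m1 m2 m3 m6.
have lin x1 x2 x3 x4 X a2 a3 a4 a5 : x1 <= 2 * 630 * a2 -> x2 <= 2 * 2900 * a3 ->
    x3 <= 2 * 210 * a4 -> x4 <= 3 * 2100 * a5 -> 0 < X -> a2 <= X -> a3 <= X -> a4 <= X ->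
    a5 <= X -> c <= X -> n <= X ->
    3 + (x1 + x2) + (x3 + (x4 + (300 * n.+1 + (4 + c.+1 * (100 + 30))))) <= 150 * 100 * X.
  by clear; lia.
apply: (lin _ _ _ _ _ (N * N) (N ^ 3) (c * N) (c * c * N ^ 3)) => //.
by apply: leq_trans nN _; apply: leq_trans NN m2.
Qed.

Lemma input_okP (V C : finType) (e : rel V) (w : {ffun V -> C}) (v0 : V) :
  input_ok e w v0 #|V| #|C| (input e w).
Proof.
split=> // [a b aV bV|a aV] /=.
  rewrite /vtx {1}cardE (nth_allpairs _ v0 v0) -?cardE //.
rewrite (nth_map v0) -?cardE // /clr /vtx; split; first exact: ltn_ord.
by rewrite nth_enum_rank.
Qed.

Lemma input_le (V C : finType) (e : rel V) (w : {ffun V -> C}) H :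
  0 < H -> #|V| <= H -> #|C| <= H -> bounded H (input e w).
Proof.
move=> H0 VH CH [|[|[|a]]] i //=.
- by case: i => [|[|i]] //=; rewrite nth_nil.
- have [lt|ge] := ltnP i (size [seq nat_of_bool (e u v) | u <- enum V, v <- enum V]); last by rewrite nth_default.
  have /allpairsP[[u v] [_ _ ->]] := mem_nth 0 lt.
  by case: (e _ _).
- have [lt|ge] := ltnP i (size (enum V)); last by rewrite nth_default // size_map.
  have /card_gt0P[v0 _] : 0 < #|V| by rewrite cardE; apply: leq_trans lt.
  by rewrite (nth_map v0) //; apply: leq_trans CH; apply: ltnW; apply: ltn_ord.
Qed.

Theorem theorem4p3 :
  exists (P : cmd) (K : nat),
  forall (V C : finType) (e : rel V) (w : {ffun V -> C}) (N : nat),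
    symmetric e -> irreflexive e ->
    graph_connected e ->
    num_connected_subgraphs e <= N ->
    exists (t : nat) (s : memory),
      exec ((K * (#|C| * N)) ^ K) P (input e w) t s /\
      t <= K * (#|C| ^ 3 * N ^ 3) /\
      correct_output e w s.
Proof.
have [K K24 timeK] := program_time_bound.
exists Program, K => V C e w N e_sym _ ce leN.
have /card_gt0P[v0 _] : 0 < #|V| by case/andP: ce.
have VN : #|V| <= N := n_le_N erefl leN.
have V0 : 0 < #|V| := n_gt0 v0 erefl.
have C0 : 0 < #|C| := c_gt0 w v0 erefl.
have N0 : 0 < N by apply: leq_trans VN.
pose D := K * (#|C| * N); pose H := (20 * #|C| * N ^ 3).+3.
have cN0 : 0 < #|C| * N by rewrite muln_gt0 C0.
have HD : H <= D ^ 3.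
  have N3 : 0 < N ^ 3 by rewrite expn_gt0 N0.
  (* Since [|C| * N ^ 3] is at least 1, it absorbs the summand 3 of [H], which gives the factor 20 +
     3; and 23 is below [K]. *)
  apply: (@leq_trans (23 ^ 3 * (#|C| ^ 3 * N ^ 3))); last first.
    by rewrite -!expnMn leq_exp2r // leq_mul2r; apply/orP; right; lia.
  have C3 : #|C| <= #|C| ^ 3 by rewrite -{1}(expn1 #|C|) leq_pexp2l.
  have : #|C| * N ^ 3 <= #|C| ^ 3 * N ^ 3 by rewrite leq_mul2r C3 orbT.
  have : 0 < #|C| * N ^ 3 by rewrite muln_gt0 C0.
  rewrite /H -mulnA; move: (_ * _) (_ * _) => x y x0 xy.
  rewrite (_ : 23 ^ 3 = 23 * 23 * 23) //; lia.
have D2 : 1 < D by rewrite /D; apply: leq_trans (leq_pmulr K cN0); lia.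
(* The exponents multiply to 3 * 8 = 24, which is below [K]. *)
have HB : H ^ max_degree < D ^ K.
  apply: (@leq_ltn_trans ((D ^ 3) ^ max_degree)); first by rewrite leq_exp2r.
  by rewrite -expnM ltn_exp2l.
have H2 : 1 < H by [].
have H_large : 20 * #|C| * N ^ 3 < H by rewrite /H; lia.
have inb : bounded H (input e w).
  have [nH _ cH _ _] := H_bounds w v0 erefl erefl H2 HB leN H_large.
  by apply: input_le => //; apply: ltnW.
have [|t [s [ex le _ co]]] := runs_program (v0 := v0) erefl erefl e_sym H2 HB leN H_large ce inb (input_okP e w v0).
  by case=> [|[|[|a]]].
exists t, s; split=> //; split=> //.
by apply: leq_trans le _; apply: timeK.
Qed.
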